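(* Let $q\geq 3$ be a prime power and let $\mathcal{B}_q$ be the incidence graph of the biaffine plane over $\mathbb{F}_q$. Then $\mathcal{B}_q$ is an extremal edge-girth-regular graph for the triple $(q,6,(q-1)^2(q-2))$; that is, $n(q,6,(q-1)^2(q-2))=2q^2$ and this minimum order is attained by $\mathcal{B}_q$.
   Context: All graphs are simple (no loops, no multiple edges). An $egr(v,k,g,\lambda)$ (edge-girth-regular graph) is a $k$-regular graph of order (number of vertices) $v$ and girth $g$ such that each of its edges is contained in exactly $\lambda$ distinct $g$-cycles (cycles of length $g$). For a fixed triple $(k,g,\lambda)$, $n(k,g,\lambda)$ denotes the smallest $v$ for which an $egr(v,k,g,\lambda)$ exists. An $egr(v,k,g,\lambda)$ is called extremal for the triple $(k,g,\lambda)$ if $v=n(k,g,\lambda)$. Let $\mathbb{F}_q$ be the finite field with $q$ elements. The biaffine plane has point set $\mathscr{P}=\mathbb{F}_q\times\mathbb{F}_q$, with elements written $(x,y)$, and line set $\mathscr{L}=\mathbb{F}_q\times\mathbb{F}_q$, with elements written $[m,b]$, where $[m,b]=\{(x,mx+b): x\in\mathbb{F}_q\}$. The graph $\mathcal{B}_q$ is the bipartite incidence graph with vertex set the disjoint union $\mathscr{P}\sqcup\mathscr{L}$, in which $(x,y)\in\mathscr{P}$ is adjacent to $[m,b]\in\mathscr{L}$ if and only if $y=mx+b$. It has order $2q^2$. *)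

(* Defs.v *)
From HB Require Import structures.
From mathcomp Require Import all_boot all_order all_algebra.

Set Implicit Arguments.
Unset Strict Implicit.
Unset Printing Implicit Defensive.

Import GRing.Theory.

Definition simple_graph (T : finType) (e : rel T) : Prop :=
  symmetric e /\ irreflexive e.

Definition regular_graph (T : finType) (e : rel T) (k : nat) : Prop :=
  forall x : T, #|[set y | e x y]| = k.

Definition cycle_edges (T : finType) (c : seq T) : {set {set T}} :=
  [set [set x; next c x] | x in c].

(* A cycle of length g is a subgraph, represented by its set of edges (edges  *)
(* being 2-element vertex sets), so that the 2 * g rooted and oriented vertex *)
(* sequences that traverse the same cycle are counted once. The bound 2 < g   *)
(* excludes the degenerate closed walks x, y, x along a single edge.          *)
Definition cycles_of_length (T : finType) (e : rel T) (g : nat) :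
    {set {set {set T}}} :=
  [set C | (2 < g) && [exists c : g.-tuple T,
             [&& cycle e c, uniq c & C == cycle_edges c]]].

Definition has_girth (T : finType) (e : rel T) (g : nat) : Prop :=
  cycles_of_length e g != set0 /\
  forall h : nat, h < g -> cycles_of_length e h = set0.

Definition is_egr (T : finType) (e : rel T) (v k g lambda : nat) : Prop :=
  [/\ simple_graph e,
      #|T| = v,
      regular_graph e k,
      has_girth e g &
      forall x y : T, e x y ->
        #|[set C in cycles_of_length e g | [set x; y] \in C]| = lambda].

Definition egr_exists (v k g lambda : nat) : Prop :=
  exists (T : finType) (e : rel T), is_egr e v k g lambda.

(* The relation "n(k, g, lambda) = v"; n(k, g, lambda) is undefined when no   *)
(* edge-girth-regular graph has these parameters.                             *)
Definition egr_min_order (k g lambda v : nat) : Prop :=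
  egr_exists v k g lambda /\
  forall w : nat, egr_exists w k g lambda -> v <= w.

Definition extremal_egr (T : finType) (e : rel T) (v k g lambda : nat) : Prop :=
  is_egr e v k g lambda /\ egr_min_order k g lambda v.

Definition prime_power (q : nat) : Prop :=
  exists p n : nat, [/\ prime p, 0 < n & q = p ^ n].

Section Biaffine.

Variable F : finFieldType.

Definition biaffine_point : finType := (F * F)%type.
Definition biaffine_line : finType := (F * F)%type.

(* The point (x, y) lies on the line [m, b] iff y = m x + b. *)
Definition biaffine_incident (P : biaffine_point) (L : biaffine_line) : bool :=
  (P.2 == L.1 * P.1 + L.2)%R.

Definition biaffine_graph : rel (biaffine_point + biaffine_line)%type :=
  fun u w => match u, w with
  | inl P, inr L | inr L, inl P => biaffine_incident P L
  | _, _ => false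
  end.

End Biaffine.

(* Main.v *)
Require Import Defs.
From mathcomp Require Import all_boot all_order all_algebra.
From mathcomp Require Import zify ring.

(** The graph of the biaffine plane is bipartite, and two points lie on at most
one common line, so its cycles have length at least 6. In any graph of girth at
least 6, the 6-cycles through an edge xy correspond to the edges that join the
vertices at distance two from x, away from y, to the vertices at distance two
from y, away from x ([card_edge_cycles]); in the biaffine plane the latter are
parametrised by two nonzero scalars and a third one different from 0 and 1
([card_hexagon_pairs]). This shows that the graph is edge-girth-regular.

For the lower bound, let xy be an edge of a graph with the same parameters, X
and Y the two sets of (q-1)^2 vertices at distance two from x and y on either
side of the edge, and W the set of the vertices outside the tree made of x, y,
their neighbours, X and Y. The tree has 2(q^2-q+1) vertices, so the claim is
|W| >= 2q-2. The 6-cycles through xy leave exactly (q-1)^2 edges from X to W,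
and as many from Y to W; as vertices of W have degree q, this gives |W| >=
2(q-1)^2/q, that is |W| >= 2q-3. In a bipartite graph no vertex of W would see
both X and Y, and |W| >= 2q-2 would be immediate; in general the case |W| =
2q-3 has to be excluded, which is the main part of the proof ([no_residue]).

Write s, t, i for the number of neighbours of a vertex of W in X, Y, W (the
last is called its inner degree), so that s+t+i = q, and s and t both sum to
(q-1)^2 while i sums to q-2. The last sum is even by the handshake lemma, so
that q is 4 or at least 8. Since there are no 4-cycles and no 5-cycles, a
vertex d of X adjacent to w in W has at least t(w) neighbours in W; moreover,
the neighbours of w in X and Y have no other common neighbour in W. Hence
2st+2i+4 <= 3q ([prod_deg_le]): no vertex of W has both many neighbours in X
and many in Y. Counting then yields a vertex with (s,t) = (q-1,1) and one with
(s,t) = (1,q-1) ([exists_full]), whose single neighbours v in Y and u in X have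
q-1 neighbours in W each. These two sets of neighbours cover W and meet in one
vertex, every other vertex of X or Y has at most two neighbours in W, and the
sum of s over W comes out wrong ([no_heavy_pair]).

For q = 4 the inequality leaves (s,t) = (2,2) possible. A single such vertex
forces every vertex of X to have 0 or 2 neighbours in W, while there are
(q-1)^2 = 9 edges from X to W ([no_inner22]). *)

Set Implicit Arguments.
Unset Strict Implicit.
Unset Printing Implicit Defensive.

Import GRing.Theory.

(** * Degrees into a set of vertices *)

Definition nbr (T : finType) (e : rel T) (x : T) : {set T} := [set y | e x y].

Definition deg_in (T : finType) (e : rel T) (A : {set T}) (x : T) : nat :=
  #|nbr e x :&: A|.

(** Closed walks instead of cycles: no vertices have to be shown distinct
before use. A closed walk of length 3 or 5 contains an odd cycle, and one of
length 4 is a cycle unless it backtracks. *)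
Definition girth_ge6 (T : finType) (e : rel T) : Prop :=
  [/\ forall a b c, e a b -> e b c -> e c a -> False,
      forall a b c d, e a b -> e b c -> e c d -> e d a -> a = c \/ b = d &
      forall a b c d f, e a b -> e b c -> e c d -> e d f -> e f a -> False].

Section Counting.
Variables (T : finType) (e : rel T).
Hypothesis eC : symmetric e.

Lemma deg_inE (A : {set T}) x : deg_in e A x = \sum_(y in A) e x y.
Proof.
rewrite /deg_in -sum1_card big_mkcond [RHS]big_mkcond /=.
by apply: eq_bigr => y _; rewrite !inE; case: (e x y); case: (y \in A).
Qed.

Lemma sum_deg_inC (A B : {set T}) :
  \sum_(a in A) deg_in e B a = \sum_(b in B) deg_in e A b.
Proof.
rewrite (eq_bigr _ (fun a _ => deg_inE B a)) exchange_big /=.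
apply: eq_bigr => b _; rewrite deg_inE.
by apply: eq_bigr => a _; rewrite eC.
Qed.

Lemma deg_inU (A B : {set T}) x : [disjoint A & B] ->
  deg_in e (A :|: B) x = deg_in e A x + deg_in e B x.
Proof.
move=> dAB; rewrite /deg_in setIUr cardsU.
have -> : nbr e x :&: A :&: (nbr e x :&: B) = set0.
  by rewrite setIACA (disjoint_setI0 dAB) setI0.
by rewrite cards0 subn0.
Qed.

Lemma deg_inD1 (A : {set T}) x w : w \in A -> e x w ->
  deg_in e A x = (deg_in e (A :\ w) x).+1.
Proof.
move=> wA xw; rewrite /deg_in (cardsD1 w (nbr e x :&: A)) !inE xw wA add1n; congr _.+1.
by apply: eq_card => z; rewrite !inE andbCA.
Qed.

Lemma deg_in_gt0P (A : {set T}) x :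
  reflect (exists2 y, y \in A & e x y) (0 < deg_in e A x).
Proof.
rewrite /deg_in card_gt0; apply: (iffP (set0Pn _)) => [[y]|[y yA xy]].
  by rewrite !inE => /andP[xy yA]; exists y.
by exists y; rewrite !inE xy.
Qed.

Lemma deg_in_gt1P (A : {set T}) x :
  reflect (exists y z, [/\ y \in A, z \in A, e x y, e x z & y != z])
          (1 < deg_in e A x).
Proof.
apply: (iffP card_gt1P) => [[y [z []]]|[y [z [yA zA xy xz nyz]]]].
  by rewrite !inE => /andP[xy yA] /andP[xz zA] nyz; exists y, z.
by exists y, z; split=> //; rewrite !inE ?xy ?xz.
Qed.

Hypothesis eI : irreflexive e.

(** Each edge inside A is counted from both of its ends. *)
Lemma sum_deg_in_even (A : {set T}) : ~~ odd (\sum_(a in A) deg_in e A a).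
Proof.
have [n] := ubnP #|A|; elim: n A => // n IHn A ltAn.
have [->|[x xA]] := set_0Vmem A; first by rewrite big_set0.
move: ltAn; rewrite -(setD1K xA) cardsU1 setD11 add1n ltnS.
set B := A :\ x => /IHn IH.
have xB : x \notin B by rewrite setD11.
have dx : [disjoint [set x] & B] by rewrite disjoints1.
have dgE y : deg_in e (x |: B) y = e y x + deg_in e B y.
  by rewrite deg_inU // deg_inE big_set1.
rewrite big_setU1 //= dgE eI add0n (eq_bigr _ (fun y _ => dgE y)) big_split /=.
under eq_bigr do rewrite eC.
by rewrite -deg_inE addnA oddD addnn odd_double.
Qed.

End Counting.

(** * The vertices outside the tree of an edge *)

(** What remains of a graph of order 2q^2-1 around an edge xy: X and Y are the
vertices at distance two from x and y on either side of the edge, W the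
vertices outside the tree. Together with the girth, these facts are all that
the contradiction needs, and they are symmetric in X and Y. *)
Record residue (T : finType) (e : rel T) (q : nat) (W X Y : {set T}) : Prop := {
  res_card : #|W| = 2 * q - 3;
  res_disj : [disjoint X & Y];
  res_deg w : w \in W -> deg_in e X w + deg_in e Y w + deg_in e W w = q;
  res_ltX w : w \in W -> deg_in e X w < q;
  res_ltY w : w \in W -> deg_in e Y w < q;
  res_sumX : \sum_(w in W) deg_in e X w = (q - 1) ^ 2;
  res_sumY : \sum_(w in W) deg_in e Y w = (q - 1) ^ 2;
  res_nbrX d w : d \in X -> w \in W -> e d w -> deg_in e Y w <= deg_in e W d < q;
  res_nbrY d w : d \in Y -> w \in W -> e d w -> deg_in e X w <= deg_in e W d < q;
  res_adjX w w' : w \in W -> w' \in W -> e w w' ->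
    deg_in e X w + deg_in e X w' < q;
  res_adjY w w' : w \in W -> w' \in W -> e w w' ->
    deg_in e Y w + deg_in e Y w' < q }.

Lemma residue_swap (T : finType) (e : rel T) q (W X Y : {set T}) :
  residue e q W X Y -> residue e q W Y X.
Proof.
case=> cW dXY dg ltX ltY sX sY nX nY aX aY; split=> //.
- by rewrite disjoint_sym.
- by move=> w /dg <-; rewrite (addnC (deg_in e Y w)).
Qed.

Section Residue.

Variables (T : finType) (e : rel T).
Hypotheses (eC : symmetric e) (eI : irreflexive e) (g6 : girth_ge6 e).

Let no3 := let: And3 h _ _ := g6 in h.
Let no4 := let: And3 _ h _ := g6 in h.

Lemma common_nbr_eq a b c d : a != b ->
  e a c -> e a d -> e b c -> e b d -> c = d.
Proof.
move=> nab ac ad bc bd; have cb : e c b by rewrite eC.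
have da : e d a by rewrite eC.
by case: (no4 ac cb bd da) nab => [->|//]; rewrite eqxx.
Qed.

Lemma deg_in_nbr_le1 (A : {set T}) a b : a != b ->
  deg_in e (nbr e a :&: A) b <= 1.
Proof.
move=> nab; rewrite leqNgt; apply/negP => /deg_in_gt1P[c [d []]].
rewrite !inE => /andP[ac _] /andP[ad _] bc bd /eqP[].
exact: (common_nbr_eq nab).
Qed.

Lemma sum_in_seq (A : {set T}) (r : seq T) (F : T -> nat) :
  uniq r -> {subset r <= A} -> size r = #|A| ->
  \sum_(x in A) F x = \sum_(x <- r) F x.
Proof.
move=> r_uniq rA szr; rewrite (big_uniq _ r_uniq); apply: eq_bigl => x.
have <- : [set y in r] = A; last by rewrite inE.
apply/eqP; rewrite eqEcard cardsE (card_uniqP r_uniq) szr leqnn andbT.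
by apply/subsetP => y; rewrite inE => /rA.
Qed.

Lemma sum_le_tight (A : {set T}) (F : T -> nat) k :
  (forall x, x \in A -> F x <= k) -> #|A| * k <= \sum_(x in A) F x ->
  forall x, x \in A -> F x = k.
Proof.
move=> leF; rewrite -sum_nat_const => geS x xA; apply/eqP.
move: geS; apply: contraTT => nFx; rewrite -ltnNge.
rewrite (bigD1 x xA) [X in _ < X](bigD1 x xA) /= -addSn leq_add //.
  by rewrite ltn_neqAle nFx leF.
by apply: leq_sum => y /andP[/leF].
Qed.

Lemma sum_ge_tight (A : {set T}) (F : T -> nat) k :
  (forall x, x \in A -> k <= F x) -> \sum_(x in A) F x <= #|A| * k ->
  forall x, x \in A -> F x = k.
Proof.
move=> leF; rewrite -sum_nat_const => geS x xA; apply/esym/eqP.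
move: geS; apply: contraTT => nFx; rewrite -ltnNge.
rewrite (bigD1 x xA) [X in _ < X](bigD1 x xA) /= -addSn leq_add //.
  by rewrite ltn_neqAle nFx leF.
by apply: leq_sum => y /andP[/leF].
Qed.

Section OneResidue.

Variables (q : nat) (W X Y : {set T}).
Hypothesis R : residue e q W X Y.

Local Notation s := (deg_in e X).
Local Notation t := (deg_in e Y).
Local Notation i := (deg_in e W).
Local Notation link w := (nbr e w :&: (X :|: Y)).

Lemma link_card w : #|link w| = s w + t w.
Proof. by rewrite -deg_inU ?(res_disj R). Qed.

(** The degrees over W sum to q(2q-3), of which 2(q-1)^2 is spent on X and Y.
*)
Lemma sum_inner : 3 <= q -> \sum_(w in W) i w = q - 2.
Proof.
move=> q3.
have : \sum_(w in W) (s w + t w + i w) = #|W| * q.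
  by rewrite -sum_nat_const; apply: eq_bigr => w; apply: res_deg.
rewrite !big_split /= (res_sumX R) (res_sumY R) (res_card R).
move: (\sum_(w in W) i w) => S; nia.
Qed.

(** Each neighbour of w in W adds at least one more unit to the sum q-2 of
inner degrees. *)
Lemma inner_le (w : T) : 3 <= q -> w \in W -> 2 * i w <= q - 2.
Proof.
move=> q3 wW; rewrite -(sum_inner q3) (bigD1 w) //= mul2n -addnn leq_add2l.
rewrite [i w]deg_inE [X in _ <= X](bigID (e w)) /=.
rewrite (bigID (e w)) /= [X in _ + X]big1 => [|y /andP[_ /negPf->] //].
rewrite addn0; apply: leq_trans (leq_addr _ _).
rewrite [X in _ <= X](eq_bigl (fun y => (y \in W) && e w y)); last first.
  by move=> y; case: eqP => [->|_]; rewrite ?eI ?andbF ?andbT.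
apply: leq_sum => y /andP[yW wy]; rewrite wy.
by apply/deg_in_gt0P; exists w; rewrite // eC.
Qed.

Lemma sum_link w : w \in W ->
  \sum_(d in link w) (i d).-1 = \sum_(w' in W :\ w) deg_in e (link w) w'.
Proof.
move=> wW; rewrite -sum_deg_inC //; apply: eq_bigr => d dw.
by rewrite (@deg_inD1 _ _ W d w) //; move: dw; rewrite !inE eC => /andP[].
Qed.

(** Two common neighbours of w and w' close a 4-cycle, one common neighbour and
the edge ww' a triangle. *)
Lemma link_common_le w w' : w' != w -> deg_in e (link w) w' + e w w' <= 1.
Proof.
rewrite eq_sym => ww'; case: (boolP (e w w')) => [we|_]; last first.
  by rewrite addn0 deg_in_nbr_le1.
rewrite addn1 ltnS leqNgt; apply/negP => /deg_in_gt0P[d].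
by rewrite !inE => /andP[wd _] w'd; apply: (no3 we w'd); rewrite eC.
Qed.

(** Outside of w, the neighbours in W of the vertices of link w form pairwise
disjoint sets, which also avoid the neighbours of w. *)
Lemma sum_link_le w : w \in W -> i w + \sum_(d in link w) (i d).-1 < #|W|.
Proof.
move=> wW; rewrite sum_link // (cardsD1 w W) wW add1n ltnS.
rewrite deg_inE (big_setD1 w) //= eI add0n -big_split /= -sum1_card.
apply: leq_sum => w'; rewrite !inE => /andP[/link_common_le].
by rewrite addnC.
Qed.

(** This is where the absence of 5-cycles enters, through res_nbrX and
res_nbrY: a neighbour of w on one side has at least as many neighbours in W as
w has on the other side. *)
Lemma sum_link_ge w : w \in W ->
  s w * (t w).-1 + t w * (s w).-1 <= \sum_(d in link w) (i d).-1.
Proof.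
move=> wW; rewrite (eq_bigl [predU nbr e w :&: X & nbr e w :&: Y]); last first.
  by move=> d; rewrite !inE andb_orr.
rewrite bigU /=; last first.
  by rewrite -setI_eq0 setIACA (disjoint_setI0 (res_disj R)) setI0.
rewrite -!sum_nat_const leq_add //; apply: leq_sum => d.
  rewrite !inE eC => /andP[dw dX].
  by have /andP[+ _] := res_nbrX R dX wW dw; lia.
rewrite !inE eC => /andP[dw dY].
by have /andP[+ _] := res_nbrY R dY wW dw; lia.
Qed.

(** Combining sum_link_ge and sum_link_le: the neighbours of w outside W need
more room in W than there is, unless s w or t w is small. *)
Lemma prod_deg_le w : 3 <= q -> w \in W -> 0 < s w -> 0 < t w ->
  2 * (s w * t w) + 2 * i w + 4 <= 3 * q.
Proof.
move=> q3 wW s0 t0; have := sum_link_le wW; have := sum_link_ge wW.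
rewrite (res_card R); have := res_deg R wW.
case: (s w) s0 => // a _; case: (t w) t0 => //= b _.
move: (\sum_(d in _) _) => S; nia.
Qed.

Section FourFour.

Hypothesis q_4 : q = 4.

Lemma inner_four w : w \in W -> i w <= 1.
Proof.
move=> wW; have := inner_le _ wW; rewrite q_4 => /(_ isT).
by rewrite -[i w <= 1](leq_pmul2l (isT : 0 < 2)).
Qed.

Lemma sum_inner_four : \sum_(w in W) i w = 2.
Proof. by rewrite sum_inner q_4. Qed.

Lemma card_inner0 : #|[set w in W | i w == 0]| = 3.
Proof.
have : \sum_(w in W) (i w + (i w == 0)) = 5.
  rewrite -[RHS](_ : #|W| = 5); last by rewrite (res_card R) q_4.
  rewrite -sum1_card; apply: eq_bigr => w /inner_four.
  by case: (i w) => [|[|]].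
rewrite big_split /= sum_inner_four => -[<-].
rewrite -sum1_card big_mkcond [RHS]big_mkcond /=; apply: eq_bigr => w _.
by rewrite inE; case: (w \in W); case: (i w == 0).
Qed.

Variable w0 : T.
Hypotheses (w0W : w0 \in W) (s0 : s w0 = 2) (t0 : t w0 = 2).

Lemma inner22 w : w \in W -> s w = 2 -> t w = 2 -> i w = 0.
Proof. by move=> wW sw tw; have := res_deg R wW; rewrite sw tw q_4 => -[]. Qed.

Lemma sum_link22 w : w \in W -> s w = 2 -> t w = 2 ->
  \sum_(d in link w) (i d).-1 <= 4.
Proof.
move=> wW sw tw; have := sum_link_le wW.
by rewrite inner22 // (res_card R) q_4.
Qed.

Lemma link22_ge2 w d : w \in W -> s w = 2 -> t w = 2 -> d \in link w -> 2 <= i d.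
Proof.
move=> wW sw tw; rewrite 3!inE eC => /andP[dw /orP[dX|dY]].
  by have /andP[+ _] := res_nbrX R dX wW dw; rewrite tw.
by have /andP[+ _] := res_nbrY R dY wW dw; rewrite sw.
Qed.

(** For q = 4 and s w = t w = 2 there is equality in sum_link_le: the four
neighbours of w outside W, with at least one further neighbour in W each,
exhaust the four other vertices of W. *)
Lemma link22_deg w d : w \in W -> s w = 2 -> t w = 2 -> d \in link w -> i d = 2.
Proof.
move=> wW sw tw dw; have d2 := link22_ge2 wW sw tw dw.
suff : (i d).-1 = 1 by case: (i d) d2 => [|[|[]]].
apply: (@sum_ge_tight (link w) (fun d => (i d).-1) 1) => //.
  by move=> x /(link22_ge2 wW sw tw); case: (i x) => [|[]].
by rewrite muln1 link_card sw tw; apply: sum_link22.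
Qed.

(** Equality in sum_link_le, read at a vertex w' instead of a vertex of link w.
*)
Lemma share22 w w' : w \in W -> s w = 2 -> t w = 2 -> w' \in W -> w' != w ->
  0 < deg_in e (link w) w'.
Proof.
move=> wW sw tw w'W w'w; apply: eq_leq; apply/esym.
apply: (@sum_le_tight (W :\ w) (deg_in e (link w)) 1); last by rewrite !inE w'w.
  move=> x; rewrite !inE => /andP[/link_common_le + _].
  by apply: leq_trans; apply: leq_addr.
rewrite -sum_link // muln1 -ltnS.
have -> : (#|W :\ w|).+1 = 5.
  by have := res_card R; rewrite (cardsD1 w) wW add1n q_4.
rewrite ltnS -(_ : #|link w| = 4); last by rewrite link_card sw tw.
rewrite -sum1_card; apply: leq_sum => d /(link22_ge2 wW sw tw).
by case: (i d) => [|[]].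
Qed.

(** By link22_deg, d misses w0. If it missed x as well, it would be adjacent to
the three other vertices of W, and two of these are adjacent to each other. *)
Lemma heavy_four_inner0 d x : d \in X :|: Y -> i d = 3 -> x \in W -> i x = 0 ->
  x != w0 -> e d x.
Proof.
move=> dXY id xW ix xw0; apply/negPn/negP => ndx.
have ndw0 : ~~ e d w0.
  apply: contra_eqN id => dw0; rewrite (link22_deg w0W s0 t0) //.
  by rewrite in_setI dXY inE eC dw0.
have dE : nbr e d :&: W = W :\ w0 :\ x.
  apply/eqP; rewrite eqEcard -/(deg_in e W d) id; apply/andP; split; last first.
    have := res_card R; rewrite (cardsD1 w0) w0W (cardsD1 x) !inE xw0 xW q_4 !add1n.
    by move=> -[->].
  apply/subsetP => y; rewrite !inE => /andP[dy ->]; rewrite andbT.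
  by apply/andP; split; [apply: contraNneq ndx | apply: contraNneq ndw0] => <-.
have [c cW ic] : exists2 c, c \in W & 0 < i c.
  apply/exists_inP; apply: contra_eqT sum_inner_four.
  by rewrite negb_exists_in => /forall_inP h; rewrite big1 // => y /h; case: (i y).
have /deg_in_gt0P[c' c'W cc'] := ic.
have ic' : 0 < i c' by apply/deg_in_gt0P; exists c; rewrite // eC.
have dN y : y \in W -> 0 < i y -> e d y.
  move=> yW iy; have : y \in nbr e d :&: W.
    rewrite dE !inE yW andbT.
    apply/andP; split; apply: contraTneq iy => ->; first by rewrite ix.
    by rewrite inner22.
  by rewrite !inE => /andP[].
by apply: (no3 (dN c cW ic) cc'); rewrite eC dN.
Qed.

(** Both vertices are adjacent to the two vertices of inner degree 0 that
differ from w0. *)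
Lemma heavy_four_uniq d d' : d \in X :|: Y -> i d = 3 -> d' \in X :|: Y -> i d' = 3 ->
  d = d'.
Proof.
move=> dXY id d'XY id'; have := card_inner0.
rewrite (cardsD1 w0) inE w0W inner22 //= add1n => -[/eqP/cards2P[x [y [xy /setP xyE]]]].
have xyP v : v \in [set x; y] -> e d v && e d' v.
  by rewrite -xyE !inE => /and3P[vw0 vW /eqP iv]; rewrite !heavy_four_inner0.
have /andP[dx d'x] := xyP x (set21 x y).
have /andP[dy d'y] := xyP y (set22 x y).
by apply: (common_nbr_eq xy); rewrite eC.
Qed.

(** The neighbour d of w in Y has degree 3 in W, hence is adjacent to the third
vertex x of inner degree 0. For (s,t) = (2,2) at x this contradicts link22_deg,
and for (1,3) it would put d into X by heavy_four_uniq. For (3,1), the two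
vertices left over, which are adjacent, would have to supply five of the nine
edges to Y. *)
Lemma no_full_with22 w : w \in W -> s w = 3 -> t w = 1 -> False.
Proof.
move=> wW sw tw.
have iw : i w = 0 by have := res_deg R wW; rewrite sw tw q_4 => -[].
have ww0 : w != w0 by apply/eqP => ww0; move: sw; rewrite ww0 s0.
have /deg_in_gt0P[d dY wd] : 0 < t w by rewrite tw.
have id : i d = 3.
  have /andP[] : s w <= i d < q by apply: (res_nbrY R); rewrite // eC.
  by rewrite sw q_4; case: (i d) => [|[|[|[|]]]].
have dXY : d \in X :|: Y by rewrite inE dY orbT.
set J := [set w in W | i w == 0]; have J3 : #|J| = 3 := card_inner0.
have w0J : w0 \in J by rewrite inE w0W inner22.
have wJ : w \in J by rewrite inE wW iw.
have /cards1P[x xE] : #|J :\ w0 :\ w| == 1.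
  by move: J3; rewrite (cardsD1 w0) w0J (cardsD1 w) in_setD1 ww0 wJ !add1n => -[->].
have [xw xw0 xW ix] : [/\ x != w, x != w0, x \in W & i x = 0].
  have : x \in J :\ w0 :\ w by rewrite xE set11.
  by rewrite !inE => /and4P[-> -> -> /eqP->].
have dx : e d x by apply: heavy_four_inner0.
have xlink : d \in link x by rewrite in_setI dXY inE eC dx.
have := res_deg R xW; have := res_ltX R xW; have := res_ltY R xW.
rewrite ix addn0 q_4 => tx3 sx3 stx.
case: (ltngtP (s x) 2) => [sx|sx|sx]; last first.
- have tx2 : t x = 2 by move: stx; rewrite sx => -[].
  by move: id; rewrite (link22_deg xW sx tx2 xlink).
- have sx' : s x = 3 by case: (s x) sx sx3 => [|[|[|[|]]]].
  have tx' : t x = 1 by move: stx; rewrite sx' => -[].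
  have [c cW ic] : exists2 c, c \in W & 0 < i c.
    apply/exists_inP; apply: contra_eqT sum_inner_four.
    by rewrite negb_exists_in => /forall_inP h; rewrite big1 // => y /h; case: (i y).
  have /deg_in_gt0P[c' c'W cc'] := ic.
  have ic' : 0 < i c' by apply/deg_in_gt0P; exists c; rewrite // eC.
  have := res_adjY R cW c'W cc'; rewrite q_4 => tcc.
  have c'c : c' != c by apply: contraTneq cc' => ->; rewrite eI.
  have neq0 y y' : 0 < i y -> i y' = 0 -> y != y'.
    by move=> iy iy'; apply: contraTneq iy => ->; rewrite iy'.
  have sumE F : \sum_(y in W) F y = \sum_(y <- [:: w0; w; x; c; c']) F y.
    apply: sum_in_seq; last by rewrite (res_card R) q_4.
      rewrite /= !inE !negb_or (eq_sym w0 w) (eq_sym w0 x) (eq_sym w x) (eq_sym c c').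
      by rewrite ww0 xw xw0 c'c !(eq_sym _ c) !(eq_sym _ c') !neq0 // inner22.
    by apply/allP; rewrite /= w0W wW xW cW c'W.
  have := res_sumY R; rewrite sumE !big_cons big_nil t0 tw tx' q_4.
  by move: tcc; clear; lia.
- have sx1 : s x = 1.
    by case: (s x) sx stx => [|[|]] // _ txE; rewrite add0n in txE; rewrite txE in tx3.
  have /deg_in_gt0P[d' d'X xd'] : 0 < s x by rewrite sx1.
  have id' : i d' = 3.
    have /andP[] : t x <= i d' < q by apply: (res_nbrX R); rewrite // eC.
    have -> : t x = 3 by move: stx; rewrite sx1 => -[].
    by rewrite q_4; case: (i d') => [|[|[|[|]]]].
  have d'XY : d' \in X :|: Y by rewrite inE d'X.
  have := disjointFr (res_disj R) d'X.
  by rewrite (heavy_four_uniq d'XY id' dXY id) dY.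
Qed.

End FourFour.

Hypothesis q4 : 3 < q.
(** Only q = 4 is concerned, where prod_deg_le still allows s w = t w = 2;
no_inner22 excludes this case. *)
Hypothesis no22 : forall w, w \in W -> s w = 2 -> t w = 2 -> q != 4.

(** As s w + t w = q, the product s w * t w exceeds the bound of prod_deg_le as
soon as both factors are at least 2, except when q = 4 and both equal 2. *)
Lemma inner0_full w : w \in W -> i w = 0 -> t w <= s w -> t w = 1.
Proof.
move=> wW i0 ts; have := res_deg R wW; have := res_ltX R wW.
have := @no22 w wW; have := @prod_deg_le w (ltnW q4) wW.
rewrite i0; case: (s w) ts => [|a] //; case: (t w) => [|[|b]] // ts; nia.
Qed.

(** For a given sum q - i w the product s w * t w grows with the smaller
factor, and from s w = i w + 2 on it exceeds the bound of prod_deg_le. *)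
Lemma s_le_inner w : w \in W -> s w < t w -> s w <= (i w).+1.
Proof.
move=> wW st; have := res_deg R wW.
have := @prod_deg_le w (ltnW q4) wW; rewrite leqNgt.
move: (s w) (t w) (i w) st => a b c; nia.
Qed.

(** Otherwise every w with t w <= s w has an inner neighbour, so that there are
at most q-2 of them, and s_le_inner limits what the other vertices contribute
to the sum of s. The sum (q-1)^2 is reached only if all these estimates are
equalities; then the first group is closed under inner adjacency and has s =
q-1 throughout, against res_adjX. *)
Lemma exists_full : exists2 w, w \in W & s w = q - 1 /\ t w = 1.
Proof.
pose A := [set w in W | t w <= s w]; pose B := [set w in W | s w < t w].
have AW w : w \in A -> w \in W by rewrite inE => /andP[].
have BW w : w \in B -> w \in W by rewrite inE => /andP[].
have sumAB F : \sum_(w in W) F w = \sum_(w in A) F w + \sum_(w in B) F w.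
  rewrite (bigID (fun w => t w <= s w)) /=; congr (_ + _); apply: eq_bigl => w.
    by rewrite inE.
  by rewrite inE ltnNge.
case: (pickP (fun w => (w \in A) && (i w == 0))) => [w /andP[wA /eqP i0]|noA].
  move: (wA); rewrite inE => /andP[wW ts]; exists w => //.
  by have := inner0_full wW i0 ts; have := res_deg R wW; lia.
have A1 w : w \in A -> 1 <= i w by move=> wA; have := noA w; rewrite wA; lia.
have cAB : #|A| + #|B| = 2 * q - 3.
  by rewrite -(res_card R) -!sum1_card sumAB.
have IAB : \sum_(w in A) i w + \sum_(w in B) i w = q - 2.
  by rewrite -sumAB sum_inner // ltnW.
have IA : #|A| <= \sum_(w in A) i w.
  by rewrite -sum1_card; apply: leq_sum.
have SA : \sum_(w in A) s w <= #|A| * (q - 1).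
  rewrite -sum_nat_const; apply: leq_sum => w /AW wW.
  by have := res_ltX R wW; lia.
have SB : \sum_(w in B) s w <= #|B| + \sum_(w in B) i w.
  rewrite -sum1_card -big_split /=; apply: leq_sum => w.
  by rewrite inE add1n => /andP[wW]; apply: s_le_inner.
have := res_sumX R; rewrite sumAB => SAB.
have [IB0 [SA1 cA]] : \sum_(w in B) i w = 0 /\
    (\sum_(w in A) s w = #|A| * (q - 1) /\ #|A| = q - 2).
  move: IA SA SB IAB cAB SAB.
  move: (\sum_(w in A) s w) (\sum_(w in B) s w) (\sum_(w in A) i w) => x y z.
  move: (\sum_(w in B) i w) #|A| #|B| => u a b *; nia.
have sA w : w \in A -> s w = q - 1.
  apply: sum_le_tight; last by rewrite SA1.
  by move=> x /AW xW; have := res_ltX R xW; lia.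
have /card_gt0P[w wA] : 0 < #|A| by lia.
have /deg_in_gt0P[w' w'W ww'] := A1 w wA.
have w'A : w' \in A.
  rewrite inE w'W /= leqNgt; apply/negP => st'.
  have w'B : w' \in B by rewrite inE w'W.
  have : 0 < i w' by apply/deg_in_gt0P; exists w; rewrite ?AW // eC.
  by move/eqP: IB0; rewrite sum_nat_eq0 => /forall_inP/(_ w' w'B)/eqP->.
by have := res_adjX R (AW w wA) w'W ww'; rewrite !sA //; lia.
Qed.

(** The only neighbour in Y of a vertex w with s w = q-1 and t w = 1 has at
least s w neighbours in W. *)
Lemma exists_heavy : exists2 v, v \in Y & i v = q - 1.
Proof.
have [w wW [sw tw]] := exists_full.
have /deg_in_gt0P[v vY wv] : 0 < t w by rewrite tw.
exists v => //; have := res_nbrY R vY wW; rewrite eC => /(_ wv).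
by rewrite sw; lia.
Qed.

Lemma sum_inner_ge3 a b c : a \in W -> b \in W -> c \in W ->
  a != b -> a != c -> b != c -> 0 < i a -> 0 < i b -> 0 < i c -> 4 < q.
Proof.
move=> aW bW cW ab ac bc ia ib ic.
have := sum_inner (ltnW q4).
rewrite (big_setD1 a aW) (big_setD1 b) ?inE 1?eq_sym ?ab //.
rewrite (big_setD1 c) ?inE ?(eq_sym c) ?ac ?bc //=; lia.
Qed.

Section TwoHeavy.

Variables (u v : T).
Hypotheses (uX : u \in X) (vY : v \in Y) (iu : i u = q - 1) (iv : i v = q - 1).

Local Notation Nu := (nbr e u :&: W).
Local Notation Nv := (nbr e v :&: W).

Lemma XY_neq x y : x \in X -> y \in Y -> x != y.
Proof.
move=> xX yY; apply/eqP => xy; have := disjointFr (res_disj R) xX.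
by rewrite xy yY.
Qed.

(** Two subsets of W with q-1 elements each and at most one common element
cannot be fitted into 2q-3 elements in any other way. *)
Lemma heavy_cover : exists2 z, Nu :&: Nv = [set z] & Nu :|: Nv = W.
Proof.
have sub : Nu :|: Nv \subset W by rewrite subUset !subsetIr.
have le1 : #|Nu :&: Nv| <= 1.
  have := deg_in_nbr_le1 W (XY_neq uX vY).
  rewrite /deg_in setIC => /(leq_trans _); apply.
  by rewrite subset_leq_card // setIA subsetIl.
have := cardsUI Nu Nv; have := subset_leq_card sub.
rewrite -/(deg_in e W u) -/(deg_in e W v) iu iv (res_card R) => leW cUI.
have /eqP/cards1P[z zE] : #|Nu :&: Nv| = 1 by lia.
exists z => //; apply/eqP; rewrite eqEcard sub (res_card R); lia.
Qed.

Variable z : T.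
Hypotheses (zE : Nu :&: Nv = [set z]) (uvW : Nu :|: Nv = W).

Lemma common_props : [/\ z \in W, e u z & e v z].
Proof.
have : z \in Nu :&: Nv by rewrite zE set11.
by rewrite !inE => /andP[/andP[-> ->] /andP[-> _]].
Qed.

Lemma NuD1_card : #|Nu :\ z| = q - 2.
Proof.
have [zW uz _] := common_props; have := iu.
by rewrite /deg_in (cardsD1 z) !inE uz zW add1n (subnS q 1) => <-.
Qed.

Lemma NvD1_card : #|Nv :\ z| = q - 2.
Proof.
have [zW _ vz] := common_props; have := iv.
by rewrite /deg_in (cardsD1 z) !inE vz zW add1n (subnS q 1) => <-.
Qed.

(** A vertex d shares at most one neighbour with u and at most one with v, and
these neighbours fill W. *)
Lemma light_le2 d : d != u -> d != v -> i d <= 2.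
Proof.
move=> du dv; rewrite -{1}uvW /deg_in setIUr.
apply: leq_trans (leq_card_setU _ _) _; apply: (@leq_add _ _ 1 1).
  by apply: deg_in_nbr_le1; rewrite eq_sym.
by apply: deg_in_nbr_le1; rewrite eq_sym.
Qed.

Lemma light_le1 d : d != u -> d != v -> e d z -> i d <= 1.
Proof.
move=> du dv dz; have [zW uz vz] := common_props.
rewrite -{1}uvW leqNgt; apply/negP => /deg_in_gt1P[a [b [aU bU da db ab]]].
have only x : x \in Nu :|: Nv -> e d x -> x = z.
  by rewrite !inE => /orP[] /andP[ux _] dx;
     [apply: (common_nbr_eq du) | apply: (common_nbr_eq dv)].
by move: ab; rewrite (only a) // (only b) // eqxx.
Qed.

Lemma u_or_v w : w \in W -> e u w || e v w.
Proof. by rewrite -{1}uvW !inE => /orP[] /andP[-> _]; rewrite ?orbT. Qed.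

Lemma u_and_v w : e u w -> e v w -> w \in W -> w = z.
Proof. by move=> uw vw wW; apply/set1P; rewrite -zE !inE uw vw wW. Qed.

(** Two adjacent vertices have no common neighbour, but each of them is
adjacent to u or v: inside W, z is isolated and the rest is bipartite. *)
Lemma inner_edge_crosses a b : a \in W -> b \in W -> e a b -> a != z /\ e u a = ~~ e u b.
Proof.
move=> aW bW ab.
have abN x : e x a -> e x b -> False.
  by move=> xa xb; apply: (no3 xa ab); rewrite eC.
split.
  apply/eqP => az; have [_ uz vz] := common_props; rewrite -az in uz vz.
  by case/orP: (u_or_v bW) => /abN; apply.
case: (boolP (e u a)) => [ua|nua].
  by apply/esym/negP => /(abN _ ua).
apply/esym/negbTE; rewrite negbK; case/orP: (u_or_v bW) => // vb.
by case/orP: (u_or_v aW) => [ua|/abN/(_ vb)//]; rewrite ua in nua.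
Qed.

(** If z has a neighbour d in X other than u, then t z <= i d <= 1. *)
Lemma s_z_or_t_z : s z = 1 \/ t z = 1.
Proof.
have [zW uz vz] := common_props.
have sz : 0 < s z by apply/deg_in_gt0P; exists u; rewrite // eC.
have tz : 0 < t z by apply/deg_in_gt0P; exists v; rewrite // eC.
case: (leqP (s z) 1) => [le1|/deg_in_gt1P[a [b [aX bX za zb ab]]]].
  by left; apply/eqP; rewrite eqn_leq le1.
have [d dX [zd du]] : exists2 d, d \in X & e z d /\ d != u.
  case: (eqVneq a u) => [au|]; last by exists a.
  by exists b => //; split=> //; rewrite -au eq_sym.
right; have dz : e d z by rewrite eC.
have /andP[le_tz _] := res_nbrX R dX zW dz.
apply/eqP; rewrite eqn_leq tz andbT (leq_trans le_tz) //.
exact: light_le1 du (XY_neq dX vY) dz.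
Qed.

(** Otherwise w would have a neighbour in X other than u and a neighbour in Y
other than v. Both have at most two neighbours in W, so s w <= 2 and t w <= 2,
and the inner degree of w would exceed inner_le. *)
Lemma heavy_single_large w : 8 <= q -> w \in W ->
  0 < s w -> 0 < t w -> ~~ e v w -> s w <= 1.
Proof.
move=> q8 wW sw tw nvw; rewrite leqNgt; apply/negP => s1.
have [d [dX du wd]] : exists d, [/\ d \in X, d != u & e d w].
  have /deg_in_gt1P[a [b [aX bX wa wb ab]]] := s1.
  case: (eqVneq a u) => [au|au]; last by exists a; rewrite eC.
  by exists b; rewrite eC -au eq_sym.
have /deg_in_gt0P[d' d'Y wd'] := tw.
have d'v : d' != v by apply: contra nvw => /eqP<-; rewrite eC.
have d'w : e d' w by rewrite eC.
have /andP[le_t _] := res_nbrX R dX wW wd.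
have /andP[le_s _] := res_nbrY R d'Y wW d'w.
have := leq_trans le_t (light_le2 du (XY_neq dX vY)).
have d'u : d' != u by rewrite eq_sym XY_neq.
have := leq_trans le_s (light_le2 d'u d'v).
have := res_deg R wW; have := inner_le (ltnW q4) wW.
by move: q8; clear; move: (s w) (t w) (i w) => a b c; lia.
Qed.

(** The vertex of exists_full has its single neighbour d in Y, and i d >= q-1 >
2 leaves only d = v. *)
Lemma full_on_heavyY : s z = 1 ->
  exists2 a, a \in Nv :\ z & s a = q - 1 /\ t a = 1.
Proof.
move=> sz1; have [a aW [sa ta]] := exists_full; exists a => //.
have /deg_in_gt0P[d dY ad] : 0 < t a by rewrite ta.
have da : e d a by rewrite eC.
have /andP[le_s _] := res_nbrY R dY aW da.
have dv : d = v.
  apply: contraTeq le_s => dv; rewrite -ltnNge sa.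
  apply: leq_ltn_trans (light_le2 _ dv) _; last by move: q4; clear; lia.
  by rewrite eq_sym XY_neq.
apply/setD1P; split; last by rewrite !inE -dv da aW.
by apply/eqP => az; move: sa; rewrite az sz1; lia.
Qed.

(** A vertex d that already shares w with x has its other neighbours in W on
the side of y. *)
Lemma light_other_nbr x y w d : (x == u) && (y == v) || (x == v) && (y == u) ->
  w \in nbr e x :&: W -> w != z -> d != u -> d != v -> e d w -> 1 < i d ->
  exists2 b, b \in (nbr e y :&: W) :\ z & e d b /\ b != w /\ e w b = false.
Proof.
move=> xy; rewrite inE [w \in nbr _ _]inE => /andP[xw wW] wz du dv dw.
have [zW uz vz] := common_props.
have dx : d != x by case/orP: xy => /andP[/eqP-> _].
have xz : e x z by case/orP: xy => /andP[/eqP-> _].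
have xyW b : b \in W -> e x b || e y b.
  by move=> /u_or_v; case/orP: xy => /andP[/eqP-> /eqP->] //; rewrite orbC.
move=> /deg_in_gt1P[b0 [b1 [b0W b1W db0 db1 b01]]].
have [b [bW db bw]] : exists b, [/\ b \in W, e d b & b != w].
  by case: (eqVneq b0 w) => [b0w|]; [exists b1; rewrite -b0w eq_sym | exists b0].
exists b; last first.
  split=> //; split=> //; apply/negbTE/negP => wb.
  by apply: (no3 dw wb); rewrite eC.
have nxb : ~~ e x b.
  by apply: contraNN bw => xb; apply/eqP; apply: (common_nbr_eq dx db dw xb xw).
rewrite !inE bW andbT; have := xyW b bW; rewrite (negPf nxb) /= => ->.
by rewrite andbT; apply: contraNneq nxb => ->.
Qed.

(** If w had a second neighbour in X, then every neighbour d of w in Y would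
have exactly two neighbours in W, the other one being some b on the side of v
with t b >= 2. The side of v has only two vertices besides z, one of them with
t = 1, so b is unique and t w = 1. Then w has an inner neighbour, which can be
neither b nor the vertex with s = 3 and t = 1. *)
Lemma heavyX_single_four w : q = 4 -> s z = 1 -> w \in Nu -> w != z -> 0 < t w -> s w = 1.
Proof.
move=> q_4 sz1 wNu wz tw.
have [uw wW] : e u w /\ w \in W by move: wNu; rewrite !inE => /andP[].
have sw : 0 < s w by apply/deg_in_gt0P; exists u; rewrite // eC.
apply/eqP; rewrite eqn_leq sw andbT leqNgt; apply/negP => s1.
have nvw : ~~ e v w by apply: contraNN wz => vw; rewrite (u_and_v uw vw wW).
have [a aV [sa ta]] := full_on_heavyY sz1.
have aW : a \in W by move: aV; rewrite !inE => /and3P[].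
have Yside d : d \in Y -> e w d ->
   exists2 b, b \in Nv :\ z & [/\ e d b, b != w, e w b = false & 1 < t b].
  move=> dY wd; have dw : e d w by rewrite eC.
  have dv : d != v by apply: contraNneq nvw => <-.
  have du : d != u by rewrite eq_sym XY_neq.
  have /andP[le_s _] := res_nbrY R dY wW dw.
  have id : 1 < i d := leq_trans s1 le_s.
  have [|b bV [db [bw wb]]] := @light_other_nbr u v w d _ wNu wz du dv dw id.
    by rewrite !eqxx.
  exists b => //; split=> //; apply/deg_in_gt1P; exists d, v.
  by split=> //; rewrite eC //; move: bV; rewrite !inE => /and3P[].
have /deg_in_gt0P[d dY wd] := tw.
have [b bV [db bw wb tb]] := Yside d dY wd.
have ab : a != b by apply: contraTneq tb => <-; rewrite ta.
(* The side of v has q - 2 = 2 vertices besides z. *)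
have Vab : Nv :\ z = [set a; b].
  apply/esym/eqP; rewrite eqEcard subUset !sub1set aV bV cards2 ab.
  by rewrite NvD1_card q_4.
have onlyb c : c \in Nv :\ z -> 1 < t c -> c = b.
  by rewrite Vab !inE => /orP[/eqP->|/eqP//]; rewrite ta.
have t1 : t w = 1.
  apply/eqP; rewrite eqn_leq tw andbT leqNgt; apply/negP.
  move=> /deg_in_gt1P[d1 [d2 [d1Y d2Y wd1 wd2 /eqP[]]]].
  have [b1 b1V [db1 _ _ tb1]] := Yside d1 d1Y wd1.
  have [b2 b2V [db2 _ _ tb2]] := Yside d2 d2Y wd2.
  apply: (@common_nbr_eq w b); rewrite ?(eq_sym w) // eC.
    by rewrite -(onlyb b1).
  by rewrite -(onlyb b2).
have s2 : s w = 2.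
  have /andP[le_s _] : s w <= i d < q by apply: (res_nbrY R dY wW); rewrite eC.
  have dv : d != v by apply: contraNneq nvw => <-; rewrite eC.
  have du : d != u by rewrite eq_sym XY_neq.
  by have := leq_trans le_s (light_le2 du dv); case: (s w) s1 => [|[|[]]].
have /deg_in_gt0P[c cW wc] : 0 < i w.
  by have := res_deg R wW; rewrite t1 s2 q_4; clear; lia.
have [_] := inner_edge_crosses wW cW wc; rewrite uw => /esym nuc.
have [cz _] : c != z /\ e u c = ~~ e u w by apply: inner_edge_crosses; rewrite // eC.
have ca : c = a.
  have : c \in Nv :\ z.
    by have := u_or_v cW; rewrite !inE cz cW (negPf nuc) /= => ->.
  by rewrite Vab !inE => /orP[/eqP//|/eqP cb]; rewrite -cb wc in wb.
have : 0 < i a by apply/deg_in_gt0P; exists w; rewrite // -ca eC.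
by have := res_deg R aW; rewrite sa ta q_4; clear; lia.
Qed.

(** The roles of u and v are exchanged with respect to heavyX_single_four,
which now applies to the vertices found on the side of u: they have t = 0,
hence an inner neighbour, and the inner degrees exceed their sum 2. *)
Lemma heavyY_single_four w : q = 4 -> s z = 1 -> w \in Nv -> w != z -> 0 < s w -> t w = 1.
Proof.
move=> q_4 sz1 wNv wz sw.
have [vw wW] : e v w /\ w \in W by move: wNv; rewrite !inE => /andP[].
have tw : 0 < t w by apply/deg_in_gt0P; exists v; rewrite // eC.
apply/eqP; rewrite eqn_leq tw andbT leqNgt; apply/negP => t1.
have nuw : ~~ e u w by apply: contraNN wz => uw; rewrite (u_and_v uw vw wW).
have Xside d : d \in X -> e w d -> t w <= 2 /\
   exists2 a, a \in Nu :\ z & [/\ e d a, a != w, e w a = false & 0 < i a].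
  move=> dX wd; have dw : e d w by rewrite eC.
  have du : d != u by apply: contraNneq nuw => <-.
  have dv : d != v by rewrite XY_neq.
  have /andP[le_t _] := res_nbrX R dX wW dw.
  split; first exact: leq_trans le_t (light_le2 du dv).
  have id : 1 < i d := leq_trans t1 le_t.
  have [|a aU [da [aw wa]]] := @light_other_nbr v u w d _ wNv wz du dv dw id.
    by rewrite !eqxx orbT.
  exists a => //; split=> //.
  have [az aNu] : a != z /\ a \in Nu by move: aU; rewrite in_setD1 => /andP[].
  have [ua aW] : e u a /\ a \in W by move: aNu; rewrite !inE => /andP[].
  have sa : 1 < s a by apply/deg_in_gt1P; exists d, u; split=> //; rewrite eC.
  have ta : t a = 0.
    apply/eqP; rewrite -leqn0 leqNgt; apply/negP.
    by move=> /(heavyX_single_four q_4 sz1 aNu az) sa1; rewrite sa1 in sa.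
  by have := res_deg R aW; have := res_ltX R aW; rewrite ta; clear; lia.
have /deg_in_gt0P[d dX wd] := sw.
have [tw2 [a aU [da aw wa ia]]] := Xside d dX wd.
have UW x : x \in Nu :\ z -> e u x /\ x \in W by rewrite !inE => /and3P[].
have [ua aW] := UW a aU.
have /deg_in_gt0P[b bW ab] := ia.
have [_] := inner_edge_crosses aW bW ab; rewrite ua => /esym nub.
have ib : 0 < i b by apply/deg_in_gt0P; exists a; rewrite // eC.
have ba : b != a by apply: contraTneq ab => ->; rewrite eI.
have q44 : (4 < q) = false by rewrite q_4.
have bw : b != w by apply: contraFneq wa => <-; rewrite eC.
have iw : i w = 0.
  apply/eqP; rewrite -leqn0 leqNgt; apply/negP => iw.
  by have := sum_inner_ge3 aW bW wW _ aw bw ia ib iw; rewrite eq_sym q44 => /(_ ba).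
have /deg_in_gt1P[d1 [d2 [d1X d2X wd1 wd2 /eqP[]]]] : 1 < s w.
  by have := res_deg R wW; rewrite iw q_4; move: tw2; clear; lia.
have [_ [a1 /UW[ua1 a1W] [da1 a1w _ ia1]]] := Xside d1 d1X wd1.
have [_ [a2 /UW[ua2 a2W] [da2 a2w _ ia2]]] := Xside d2 d2X wd2.
have a12 : a1 = a2.
  apply: contraFeq q44 => a12; apply: (sum_inner_ge3 a1W a2W bW a12 _ _ ia1 ia2 ib).
    by apply: contraNneq nub => <-.
  by apply: contraNneq nub => <-.
by apply: (@common_nbr_eq a1 w) => //; rewrite eC // a12.
Qed.

Hypothesis sz1 : s z = 1.
Hypothesis HU : forall w, w \in Nu -> w != z -> 0 < t w -> s w = 1.
Hypothesis HV : forall w, w \in Nv -> w != z -> 0 < s w -> t w = 1.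

(** On the side of u, s is 1 except where t = 0; on the side of v, t is 1
except where s = 0. If p and p' count these exceptions, comparing the sum of s
with (q-1)^2 yields (q-1)(p-p') = I, where I is a sum of inner degrees with 0
<= I <= q-2. So I = 0, which forces p = p' = 0 and leaves no inner edge at all,
although inner degrees sum to q-2 > 0. *)
Lemma no_heavy_pair : False.
Proof.
have [zW uz vz] := common_props.
pose U := Nu :\ z; pose V := Nv :\ z.
have sumW F : \sum_(w in W) F w = F z + (\sum_(w in U) F w + \sum_(w in V) F w).
  rewrite (big_setD1 z zW) (bigID (e u)) /=; congr (_ + (_ + _)); apply: eq_bigl => w.
    by rewrite !inE; case: (w == z); rewrite //= andbC.
  rewrite !inE; case: (eqVneq w z) => //= nwz.
  case: (boolP (w \in W)) => wW /=; last by rewrite andbF.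
  rewrite andbT; case: (boolP (e u w)) => uw /=; last first.
    by have := u_or_v wW; rewrite (negPf uw).
  by apply/esym/negP => vw; move/eqP: nwz; apply; apply: u_and_v.
have cU : #|U| = q - 2 by apply: NuD1_card.
have cV : #|V| = q - 2 by apply: NvD1_card.
have EU : \sum_(w in U) (s w + (t w == 0) * i w) =
          \sum_(w in U) (1 + (q - 1) * (t w == 0)).
  apply: eq_bigr => w; rewrite inE => /andP[/set1P/eqP wz wNu].
  have wW : w \in W by move: wNu; rewrite inE => /andP[].
  have := res_deg R wW; have := HU wNu wz.
  by move: q4; clear; case: (t w) => [|c] /=; move: (s w) (i w) => a b; lia.
have EV : \sum_(w in V) (s w + (0 < s w) * i w + (q - 1) * (s w == 0)) =
          \sum_(w in V) (q - 1).
  apply: eq_bigr => w; rewrite inE => /andP[/set1P/eqP wz wNv].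
  have wW : w \in W by move: wNv; rewrite inE => /andP[].
  have := res_deg R wW; have := HV wNv wz.
  by move: q4; clear; case: (s w) => [|a] /=; move: (t w) (i w) => b c; lia.
have IU : \sum_(w in U) (t w == 0 : nat) <= \sum_(w in U) (t w == 0) * i w.
  apply: leq_sum => w; rewrite !inE => /and3P[_ _ wW].
  by have := res_deg R wW; have := res_ltX R wW; case: eqP => [->|]; lia.
have IU' : \sum_(w in U) (t w == 0) * i w <= \sum_(w in U) i w.
  by apply: leq_sum => w _; case: eqP; lia.
have IV' : \sum_(w in V) (0 < s w) * i w <= \sum_(w in V) i w.
  by apply: leq_sum => w _; case: (0 < _); lia.
have := res_sumX R; rewrite sumW sz1 => S1.
have := sum_inner (ltnW q4); rewrite sumW => S2.
have iz : i z = 0.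
  apply/eqP; rewrite -leqn0 leqNgt; apply/negP => /deg_in_gt0P[b bW zb].
  by have [] := inner_edge_crosses zW bW zb; rewrite eqxx.
move: EU EV; rewrite !big_split /= -!big_distrr /= !sum_nat_const cU cV muln1 => EU EV.
have [P0 [Q0 J0]] : \sum_(w in U) (t w == 0 : nat) = 0 /\
   (\sum_(w in V) (s w == 0 : nat) = 0 /\ \sum_(w in V) (0 < s w) * i w = 0).
  move: EU EV IU IU' IV' S1 S2.
  set a := \sum_(w in U) s w; set b := \sum_(w in V) s w.
  set p := \sum_(w in U) (t w == 0 : nat); set p' := \sum_(w in V) (s w == 0 : nat).
  set Ip := \sum_(w in U) (t w == 0) * i w; set In := \sum_(w in V) (0 < s w) * i w.
  set IU := \sum_(w in U) i w; set IV := \sum_(w in V) i w.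
  clearbody a b p p' Ip In IU IV => *.
  (* Ip and In are the inner degrees of the exceptions on the side of u and of
  the non-exceptions on the side of v. *)
  have E : Ip + In + (q - 1) * p' = (q - 1) * p by nia.
  have pp : p = p' by nia.
  by subst p'; lia.
have iV w : w \in V -> i w = 0.
  move=> wV; move/eqP: J0; rewrite sum_nat_eq0 => /forall_inP/(_ w wV).
  move/eqP: Q0; rewrite sum_nat_eq0 => /forall_inP/(_ w wV).
  by case: (s w) => //= a _; rewrite mul1n => /eqP.
have iU w : w \in U -> i w = 0.
  rewrite !inE => /and3P[wz uw wW].
  apply/eqP; rewrite -leqn0 leqNgt; apply/negP => /deg_in_gt0P[b bW wb].
  have [_] := inner_edge_crosses wW bW wb; rewrite uw => /esym nub.
  have [bz _] : b != z /\ e u b = ~~ e u w by apply: inner_edge_crosses; rewrite // eC.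
  have bV : b \in V by have := u_or_v bW; rewrite !inE bz bW (negPf nub) /= => ->.
  have : 0 < i b by apply/deg_in_gt0P; exists w; rewrite // eC.
  by rewrite iV.
by move: S2; rewrite iz !big1 //; lia.
Qed.

End TwoHeavy.

End OneResidue.

Section NoResidue.

Variables (q : nat) (W X Y : {set T}).
Hypothesis R : residue e q W X Y.

Local Notation s := (deg_in e X).
Local Notation t := (deg_in e Y).
Local Notation i := (deg_in e W).
Local Notation link w := (nbr e w :&: (X :|: Y)).

Lemma inner0_all22 w0 w : q = 4 -> w0 \in W -> s w0 = 2 -> t w0 = 2 ->
  w \in W -> i w = 0 -> s w = 2 /\ t w = 2.
Proof.
move=> q_4 w0W s0 t0 wW iw.
have := res_deg R wW; have := res_ltX R wW; have := res_ltY R wW.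
have no31X := no_full_with22 R q_4 w0W s0 t0 wW.
have no31Y := no_full_with22 (residue_swap R) q_4 w0W t0 s0 wW.
rewrite iw addn0 q_4 => tw3 sw3 stw.
have sw : s w = 4 - t w by rewrite -stw addnK.
case: (t w) tw3 sw no31X no31Y => [|[|[|[|]]]] // _ sw.
- by rewrite sw in sw3.
- by move=> /(_ sw erefl).
- by move=> _ /(_ erefl sw).
Qed.

(** All three vertices of inner degree 0 have s = t = 2. A vertex c of inner
degree 1 shares a neighbour with each of them; these three neighbours are
distinct, so they are all the neighbours of c outside W. Therefore every vertex
of X has 0 or 2 neighbours in W, and the sum of s cannot be 9. *)
Lemma no_inner22 w0 : q = 4 -> w0 \in W -> s w0 = 2 -> t w0 = 2 -> False.
Proof.
move=> q_4 w0W s0 t0.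
pose J := [set w in W | i w == 0].
have JP w : w \in J -> [/\ w \in W, s w = 2 & t w = 2].
  by rewrite inE => /andP[wW /eqP iw]; have [] := inner0_all22 q_4 w0W s0 t0 wW iw.
have linkJ w d : w \in J -> d \in link w -> i d = 2.
  by move=> /JP[wW sw tw]; apply: (link22_deg R q_4 wW sw tw).
(* The degree in W of a vertex of X is 0 or 2. *)
have even_i d : d \in X -> ~~ odd (i d).
  move=> dX; case: (posnP (i d)) => [->//|/deg_in_gt0P[c cW dc]].
  have dlc : d \in link c by rewrite !inE eC dc dX.
  case: (boolP (c \in J)) => [cJ|ncJ]; first by rewrite (linkJ c d).
  have ic1 : i c = 1.
    apply/eqP; rewrite eqn_leq (inner_four R q_4 cW) lt0n.
    by apply: contraNN ncJ => ic; rewrite inE cW.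
  have clink3 : #|link c| = 3.
    rewrite (link_card R); apply/eqP; rewrite -(eqn_add2r 1) -{1}ic1.
    by rewrite (res_deg R cW) q_4.
  have le1 x : x \in link c -> deg_in e J x <= 1.
    move=> xlc; rewrite leqNgt; apply/negP => J2.
    have /deg_in_gt0P[y yJ xy] : 0 < deg_in e J x by apply: ltnW.
    have [yW _ _] := JP y yJ.
    have ix : i x = 2.
      by apply: (linkJ y) => //; move: xlc; rewrite !inE => /andP[_ ->]; rewrite eC xy.
    have : deg_in e J x < i x.
      have JW : J \subset W :\ c.
        apply/subsetP => v vJ; have [vW _ _] := JP v vJ; rewrite !inE vW andbT.
        by apply: contraNneq ncJ => <-.
      rewrite (@deg_inD1 _ e W x c) //; last by move: xlc; rewrite !inE eC => /andP[].
      by rewrite ltnS; apply: subset_leq_card; apply: setIS.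
    by rewrite ix ltnNge J2.
  have : deg_in e J d = 1.
    apply: (sum_le_tight le1) => //; rewrite muln1 clink3.
    rewrite -sum_deg_inC // -(card_inner0 R q_4) -sum1_card.
    apply: leq_sum => w wJ; have [wW sw tw] := JP w wJ.
    have cw : c != w by apply: contraNneq ncJ => ->.
    have /deg_in_gt0P[x] := share22 R q_4 wW sw tw cW cw.
    rewrite !inE => /andP[wx xXY] cx.
    by apply/deg_in_gt0P; exists x; rewrite // !inE cx.
  move=> Jd; have /deg_in_gt0P[y yJ dy] : 0 < deg_in e J d by rewrite Jd.
  by rewrite (linkJ y d) // !inE eC dy dX.
have : odd (\sum_(d in X) i d) by rewrite sum_deg_inC // (res_sumX R) q_4.
apply/negP; elim/big_ind: _ => // a b; rewrite oddD.
by move=> /negPf-> /negPf->.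
Qed.

Lemma residue_inner_even : 3 <= q -> ~~ odd q.
Proof.
move=> q3; have := sum_deg_in_even eC eI W; rewrite (sum_inner R q3).
by rewrite oddB ?addbF // ltnW.
Qed.

End NoResidue.

Lemma no_residue q W X Y : q = 4 \/ 8 <= q -> ~ residue e q W X Y.
Proof.
move=> q48 R.
have q4 : 3 < q by case: q48 => [->//|]; apply: leq_trans.
have n22 A B : residue e q W A B ->
  forall w, w \in W -> deg_in e A w = 2 -> deg_in e B w = 2 -> q != 4.
  by move=> RAB w wW sw tw; apply/eqP => /(no_inner22 RAB)/(_ wW sw tw).
have R' := residue_swap R.
have [v vY iv] := exists_heavy R q4 (n22 _ _ R).
have [u uX iu] := exists_heavy R' q4 (n22 _ _ R').
have claim A B (RAB : residue e q W A B) x y z : x \in A -> y \in B ->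
    deg_in e W x = q - 1 -> deg_in e W y = q - 1 ->
    nbr e x :&: W :&: (nbr e y :&: W) = [set z] ->
    (nbr e x :&: W) :|: (nbr e y :&: W) = W -> deg_in e A z = 1 -> False.
  move=> xA yB ix iy zE cov sz.
  apply: (no_heavy_pair RAB q4 xA yB ix iy zE cov sz) => w wN wz.
    case: q48 => [q_4|q8 tw].
      exact: (heavyX_single_four RAB q4 (n22 _ _ RAB) xA yB ix iy zE cov q_4 sz wN wz).
    have [xw wW] : e x w /\ w \in W by move: wN; rewrite !inE => /andP[].
    have nyw : ~~ e y w.
      by apply: contraNN wz => yw; rewrite (u_and_v zE xw yw wW).
    have sw : 0 < deg_in e A w by apply/deg_in_gt0P; exists x; rewrite // eC.
    apply/eqP; rewrite eqn_leq sw andbT.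
    exact: (heavy_single_large RAB q4 xA yB cov q8 wW sw tw nyw).
  case: q48 => [q_4|q8 sw].
    exact: (heavyY_single_four RAB q4 (n22 _ _ RAB) xA yB ix iy zE cov q_4 sz wN wz).
  have [yw wW] : e y w /\ w \in W by move: wN; rewrite !inE => /andP[].
  have nxw : ~~ e x w.
    by apply: contraNN wz => xw; rewrite (u_and_v zE xw yw wW).
  have tw : 0 < deg_in e B w by apply/deg_in_gt0P; exists y; rewrite // eC.
  apply/eqP; rewrite eqn_leq tw andbT.
  apply: (heavy_single_large (residue_swap RAB) q4 yB xA _ q8 wW tw sw nxw).
  by rewrite setUC.
have [z zE cov] := heavy_cover R q4 uX vY iu iv.
have [sz|tz] := s_z_or_t_z R uX vY zE cov.
  exact: (claim _ _ R _ _ _ uX vY iu iv zE cov sz).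
apply: (claim _ _ R' v u z vY uX iv iu _ _ tz); first by rewrite setIC.
by rewrite setUC.
Qed.
End Residue.

(** * Counting around an edge *)

(** In a graph of girth at least 6: the leaves, on the side of x, of the tree
of depth two grown from the edge xy. *)
Definition branch (T : finType) (e : rel T) (x y : T) : {set T} :=
  [set c | [exists a, [&& e x a, a != y, e a c & c != x]]].

Section Branch.

Variables (T : finType) (e : rel T) (q : nat).
Hypotheses (eC : symmetric e) (g6 : girth_ge6 e).

Let no3 := let: And3 h _ _ := g6 in h.
Let no4 := let: And3 _ h _ := g6 in h.
Let no5 := let: And3 _ _ h := g6 in h.

Lemma branchP x y c :
  reflect (exists a, [/\ e x a, a != y, e a c & c != x]) (c \in branch e x y).
Proof.
rewrite inE; apply: (iffP existsP) => -[a]; first by case/and4P; exists a.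
by case=> *; exists a; apply/and4P.
Qed.

Lemma branch_parent x y c : c \in branch e x y -> deg_in e (nbr e x :\ y) c = 1.
Proof.
case/branchP => a [xa ay ac cx]; apply/eqP; rewrite eqn_leq; apply/andP; split.
  by rewrite setDE; apply: deg_in_nbr_le1; rewrite // eq_sym.
by apply/deg_in_gt0P; exists a; rewrite ?inE ?ay // eC.
Qed.

Lemma deg_branch_sum x y p : deg_in e (branch e x y) p =
  \sum_(a in nbr e x :\ y) deg_in e (nbr e p :&: branch e x y) a.
Proof.
rewrite sum_deg_inC // /deg_in -sum1_card; apply: eq_bigr => c.
by rewrite in_setI => /andP[_ /branch_parent].
Qed.

Lemma deg_branch_le x y p : p \notin nbr e x :\ y ->
  deg_in e (branch e x y) p <= #|nbr e x :\ y|.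
Proof.
move=> pC; rewrite deg_branch_sum -sum1_card; apply: leq_sum => a aC.
by apply: deg_in_nbr_le1 => //; apply: contraNneq pC => ->.
Qed.

(** A vertex a that leads to both p and p' through the branch would close a
5-cycle with the edge pp'; one that leads to p in two ways, a 4-cycle. *)
Lemma deg_branch_adj x y p p' :
  p \notin nbr e x :\ y -> p' \notin nbr e x :\ y -> e p p' ->
  deg_in e (branch e x y) p + deg_in e (branch e x y) p' <= #|nbr e x :\ y|.
Proof.
move=> pC p'C pp'; rewrite !deg_branch_sum -big_split /= -sum1_card.
apply: leq_sum => a aC.
have pa : p != a by apply: contraNneq pC => ->.
have p'a : p' != a by apply: contraNneq p'C => ->.
have := deg_in_nbr_le1 eC g6 (branch e x y) pa.
have := deg_in_nbr_le1 eC g6 (branch e x y) p'a.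
have [->|/deg_in_gt0P[u]] := posnP (deg_in e (nbr e p :&: branch e x y) a); first by [].
have [->|/deg_in_gt0P[u']] := posnP (deg_in e (nbr e p' :&: branch e x y) a).
  by rewrite addn0.
rewrite !inE => /andP[p'u' _] au' /andP[pu _] au.
by case: (@no5 a u p p' u'); rewrite // eC.
Qed.

Hypothesis reg : regular_graph e q.
Variables (x y : T).
Hypothesis xy : e x y.

Lemma card_children : #|nbr e x :\ y| = q - 1.
Proof. by have := reg x; rewrite (cardsD1 y) inE xy => <-; rewrite addKn. Qed.

Lemma card_branch : #|branch e x y| = (q - 1) ^ 2.
Proof.
rewrite expnS expn1 -{1}card_children -sum_nat_const.
transitivity (\sum_(c in branch e x y) deg_in e (nbr e x :\ y) c).
  by rewrite -sum1_card; apply: eq_bigr => c /branch_parent->.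
rewrite sum_deg_inC //; apply: eq_bigr => a; rewrite !inE => /andP[ay xa].
have := reg a; rewrite (cardsD1 x) inE eC xa => <-; rewrite addKn /deg_in.
apply: eq_card => c; rewrite !inE; apply/andP/andP => -[].
  by move=> ac /existsP[b /and4P[]].
by move=> cx ac; split=> //; apply/existsP; exists a; rewrite xa ay ac.
Qed.

Lemma disjoint_nbr : [disjoint nbr e x & nbr e y].
Proof.
apply/pred0P => c /=; rewrite !inE; apply/negP => /andP[xc yc].
by apply: (no3 xc _ (_ : e y x)); rewrite eC.
Qed.

Lemma disjoint_nbr_branch : [disjoint nbr e x & branch e x y].
Proof.
apply/pred0P => c /=; apply/negP => /andP[]; rewrite inE => xc /branchP[a [xa _ ac _]].
by apply: (no3 xa ac); rewrite eC.
Qed.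

Lemma disjoint_nbr_branchC : [disjoint nbr e x & branch e y x].
Proof.
apply/pred0P => c /=; apply/negP => /andP[].
rewrite inE => xc /branchP[b [yb /eqP bx bc /eqP cy]].
by have [] := @no4 x y b c xy yb bc; rewrite 1?eC // => /esym.
Qed.

Lemma disjoint_branch : [disjoint branch e x y & branch e y x].
Proof.
apply/pred0P => c /=; apply/negP.
move=> /andP[/branchP[a [xa _ ac _]] /branchP[b [yb _ bc _]]].
by apply: (@no5 x a c b y); rewrite // eC.
Qed.

Lemma branch_nbr0 c : c \in branch e x y -> deg_in e (nbr e y) c = 0.
Proof.
case/branchP => a [xa _ ac _]; apply/eqP; rewrite -leqn0 leqNgt.
apply/negP => /deg_in_gt0P[b]; rewrite inE => yb cb.
by apply: (@no5 x a c b y); rewrite // eC.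
Qed.

Lemma branch_inner0 c : c \in branch e x y -> deg_in e (branch e x y) c = 0.
Proof.
case/branchP => a [xa _ ac _]; apply/eqP; rewrite -leqn0 leqNgt.
apply/negP => /deg_in_gt0P[d /branchP[b [xb _ bd _]] cd].
by apply: (@no5 x a c d b); rewrite // eC.
Qed.

Lemma branch_nbr1 c : c \in branch e x y -> deg_in e (nbr e x) c = 1.
Proof.
case/branchP => a [xa ay ac cx]; apply/eqP; rewrite eqn_leq; apply/andP; split.
  by rewrite -[nbr e x]setIT; apply: deg_in_nbr_le1; rewrite // eq_sym.
by apply/deg_in_gt0P; exists a; rewrite ?inE // eC.
Qed.

End Branch.

Section Order.

Variables (T : finType) (e : rel T) (q : nat).
Hypotheses (eC : symmetric e) (g6 : girth_ge6 e).
Hypothesis reg : regular_graph e q.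

Definition rest (x y : T) : {set T} :=
  ~: (nbr e x :|: nbr e y :|: branch e x y :|: branch e y x).

Lemma restC x y : rest x y = rest y x.
Proof. by rewrite /rest (setUC (nbr e x)) -!setUA (setUC (branch e x y)). Qed.

Lemma rest_not_nbr x y w : w \in rest x y -> w \notin nbr e x :\ y.
Proof. by rewrite !inE !negb_or -!andbA => /and4P[/negPf-> _ _ _]; rewrite andbF. Qed.

Lemma deg_split x y p : e x y ->
  q = deg_in e (nbr e x) p + deg_in e (nbr e y) p + deg_in e (branch e x y) p
      + deg_in e (branch e y x) p + deg_in e (rest x y) p.
Proof.
move=> xy; have yx : e y x by rewrite eC.
have d1 := disjoint_nbr eC g6 xy; have d2 := disjoint_branch eC g6 xy.
have d3 := disjoint_nbr_branch eC g6 x y; have d4 := disjoint_nbr_branch eC g6 y x.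
have d5 := disjoint_nbr_branchC eC g6 xy; have d6 := disjoint_nbr_branchC eC g6 yx.
rewrite -!deg_inU.
- by rewrite setUCr /deg_in setIT reg.
- by rewrite -setI_eq0 setICr.
- by rewrite -!setI_eq0 !setIUl !setU_eq0 !setI_eq0 d5 d4 d2.
- by rewrite -!setI_eq0 !setIUl !setU_eq0 !setI_eq0 d3 d6.
- exact: d1.
Qed.

Lemma card_rest x y : e x y -> #|rest x y| + 2 * q + 2 * (q - 1) ^ 2 = #|T|.
Proof.
move=> xy; have yx : e y x by rewrite eC.
have d1 := disjoint_nbr eC g6 xy; have d2 := disjoint_branch eC g6 xy.
have d3 := disjoint_nbr_branch eC g6 x y; have d4 := disjoint_nbr_branch eC g6 y x.
have d5 := disjoint_nbr_branchC eC g6 xy; have d6 := disjoint_nbr_branchC eC g6 yx.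
have cU (A B : {set T}) : [disjoint A & B] -> #|A :|: B| = #|A| + #|B|.
  by move=> /disjoint_setI0 AB; rewrite cardsU AB cards0 subn0.
rewrite -(cardsC (rest x y)) setCK -!addnA !cU.
- rewrite (reg x) (reg y) (card_branch eC g6 reg xy).
  by rewrite (card_branch eC g6 reg yx) !mul2n -!addnn !addnA addn0.
- exact: d1.
- by rewrite -!setI_eq0 !setIUl !setU_eq0 !setI_eq0 d3 d6.
- by rewrite -!setI_eq0 !setIUl !setU_eq0 !setI_eq0 d5 d4 d2.
Qed.

Lemma rest_nbr0 x y w : e x y -> w \in rest x y -> deg_in e (nbr e x) w = 0.
Proof.
move=> xy wW; apply/eqP; rewrite -leqn0 leqNgt; apply/negP => /deg_in_gt0P[a].
move: wW; rewrite !inE !negb_or -!andbA => /and4P[nxw nyw nX _] xa wa.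
have [ay|ay] := eqVneq a y; first by rewrite eC -ay wa in nyw.
case/negP: nX; apply/existsP; exists a; rewrite xa ay eC wa /=.
by apply: contraNneq nyw => ->; rewrite eC.
Qed.

Variables (x y : T).
Hypothesis xy : e x y.

Local Notation X := (branch e x y).
Local Notation Y := (branch e y x).
Local Notation W := (rest x y).

Lemma deg_branch c : c \in X -> deg_in e Y c + deg_in e W c = q - 1.
Proof.
move=> cX; have := deg_split c xy.
rewrite (branch_nbr1 eC g6 cX) (branch_nbr0 eC g6 xy cX) (branch_inner0 eC g6 cX).
by rewrite addn0 addn0 -addnA add1n => qE; rewrite [in RHS]qE subn1.
Qed.

Lemma deg_rest w : w \in W -> deg_in e X w + deg_in e Y w + deg_in e W w = q.
Proof.
move=> wW; have yx : e y x by rewrite eC.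
have := deg_split w xy; rewrite (rest_nbr0 xy wW).
by rewrite restC in wW; rewrite (rest_nbr0 yx wW).
Qed.

Lemma sum_deg_rest l : l = \sum_(c in X) deg_in e Y c ->
  \sum_(w in W) deg_in e X w + l = (q - 1) ^ 3.
Proof.
move=> ->; rewrite sum_deg_inC // addnC -big_split /=.
rewrite (eq_bigr _ (@deg_branch)) sum_nat_const (card_branch eC g6 reg xy).
by rewrite -expnSr.
Qed.

Lemma rest_ltX w : w \in W -> deg_in e X w < q.
Proof.
move=> wW; have q1 : 0 < q by rewrite -(reg x); apply/card_gt0P; exists y; rewrite inE.
have := deg_branch_le eC g6 (rest_not_nbr wW).
by rewrite (card_children reg xy) subn1 -ltnS prednK.
Qed.

Lemma rest_adj w w' : w \in W -> w' \in W -> e w w' ->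
  deg_in e X w + deg_in e X w' < q.
Proof.
move=> wW w'W ww'.
have q1 : 0 < q by rewrite -(reg x); apply/card_gt0P; exists y; rewrite inE.
have := deg_branch_adj eC g6 (rest_not_nbr wW) (rest_not_nbr w'W) ww'.
by rewrite (card_children reg xy) subn1 -ltnS prednK.
Qed.

(** The neighbours of d and of w in the opposite branch hang from different
children of y, and the children of y that d does not use are as many as the
neighbours of d in W. *)
Lemma rest_branch d w : d \in X -> w \in W -> e d w ->
  deg_in e Y w <= deg_in e W d < q.
Proof.
move=> dX wW dw; have yx : e y x by rewrite eC.
have q1 : 0 < q by rewrite -(reg x); apply/card_gt0P; exists y; rewrite inE.
have dE := deg_branch dX.
have dC : d \notin nbr e y :\ x.
  have := disjointFl (disjoint_nbr_branchC eC g6 yx) dX.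
  by rewrite !inE => ->; rewrite andbF.
have wC : w \notin nbr e y :\ x by rewrite restC in wW; apply: rest_not_nbr wW.
have := deg_branch_adj eC g6 dC wC dw.
rewrite (card_children reg yx); move: q1 dE; clear; lia.
Qed.

End Order.

Section LowerBound.

Variables (T : finType) (e : rel T) (q : nat).
Hypotheses (eC : symmetric e) (eI : irreflexive e) (g6 : girth_ge6 e).
Hypothesis reg : regular_graph e q.

(** This is where the number of 6-cycles enters: of the (q-1)^3 edges leaving
the branch of x away from x, (q-1)^2(q-2) end in the branch of y, so that
(q-1)^2 end in the rest. *)
Lemma residue_rest x y : 3 <= q -> #|T| < 2 * q ^ 2 -> e x y ->
  \sum_(c in branch e x y) deg_in e (branch e y x) c = (q - 1) ^ 2 * (q - 2) ->
  residue e q (rest e x y) (branch e x y) (branch e y x).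
Proof.
move=> q3 Tlt xy lam; have yx : e y x by rewrite eC.
(* Edges between the branches are counted from either side. *)
have lam' : \sum_(c in branch e y x) deg_in e (branch e x y) c = (q - 1) ^ 2 * (q - 2).
  by rewrite sum_deg_inC.
have sX := sum_deg_rest eC g6 reg xy (esym lam).
have sY := sum_deg_rest eC g6 reg yx (esym lam').
have cube (S : nat) : S + (q - 1) ^ 2 * (q - 2) = (q - 1) ^ 3 -> S = (q - 1) ^ 2.
  move=> SE; apply/eqP; rewrite -(eqn_add2r ((q - 1) ^ 2 * (q - 2))) SE.
  by rewrite -mulnS expnSr; apply/eqP; congr (_ * _); move: q3; clear; lia.
move/cube: sX => sX; move/cube: sY => sY; rewrite restC in sY.
have dR := deg_rest eC g6 reg xy.
split=> //.
- have := card_rest eC g6 reg xy.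
  have : 2 * (q - 1) ^ 2 <= #|rest e x y| * q.
    rewrite -sum_nat_const mul2n -addnn -{1}sX -sY -big_split /=.
    by apply: leq_sum => w /dR <-; apply: leq_addr.
  move: Tlt q3; clear; move: #|T| #|rest e x y| => n w; nia.
- exact: disjoint_branch.
- exact: rest_ltX.
- by move=> w; rewrite restC; apply: rest_ltX.
- exact: rest_branch.
- by move=> d w; rewrite restC; apply: rest_branch.
- exact: rest_adj.
- by move=> w w'; rewrite restC; apply: rest_adj.
Qed.

Lemma order_lower_bound x y : prime_power q -> 3 <= q -> e x y ->
  \sum_(c in branch e x y) deg_in e (branch e y x) c = (q - 1) ^ 2 * (q - 2) ->
  2 * q ^ 2 <= #|T|.
Proof.
move=> pq q3 xy lam; rewrite leqNgt; apply/negP => Tlt.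
have R := residue_rest q3 Tlt xy lam.
apply: (no_residue eC eI g6 _ R).
have := residue_inner_even eC eI R q3.
case: pq q3 => p [n [p_pr n0 ->]]; rewrite oddX negb_or => q3 /andP[_ /negPf podd].
(* An even prime power is a power of 2; here it is 4 or at least 8. *)
have [p2|] := even_prime p_pr; last by rewrite podd.
rewrite p2 in q3 *; case: n {n0} q3 => [|[|[|n]]] // _; [by left | right].
by rewrite (@leq_exp2l 2 3).
Qed.

End LowerBound.

(** * Cycles of length six through an edge *)

Section CycleEdges.

Variable T : finType.
Implicit Types s c : seq T.

Lemma set2_eqP (a b c d : T) : [set a; b] = [set c; d] ->
  (a = c /\ b = d) \/ (a = d /\ b = c).
Proof.
move=> E.
have : a \in [set c; d] by rewrite -E set21.
have : b \in [set c; d] by rewrite -E set22.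
have : c \in [set a; b] by rewrite E set21.
have : d \in [set a; b] by rewrite E set22.
by rewrite !inE; do 4 case/orP => /eqP ?; intuition congruence.
Qed.

Lemma mem_cycle_edges c p r : [set p; r] \in cycle_edges c ->
  (p \in c /\ next c p = r) \/ (r \in c /\ next c r = p).
Proof.
by case/imsetP => u uc /set2_eqP[] [-> ->]; [left | right].
Qed.

Lemma next_nth_succ x0 s k : uniq s -> k.+1 < size s ->
  next s (nth x0 s k) = nth x0 s k.+1.
Proof.
case: s => // y s us ks; rewrite next_nth mem_nth ?(ltnW ks) //.
by rewrite index_uniq ?(ltnW ks) //=; apply: set_nth_default.
Qed.

(** The edge set determines a cycle up to the starting point and the direction,
and the first two vertices fix both. *)
Lemma cycle_edges_inj x y s s' : uniq (x :: y :: s) -> uniq (x :: y :: s') ->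
  size s = size s' -> cycle_edges (x :: y :: s) = cycle_edges (x :: y :: s') ->
  s = s'.
Proof.
set p := x :: y :: s; set p' := x :: y :: s' => up up' szs pp'.
have szp : size p = size p' by rewrite /= szs.
suff np k : k.+1 < size p -> nth x p k = nth x p' k /\ nth x p k.+1 = nth x p' k.+1.
  have : p = p'.
    apply: (@eq_from_nth _ x) => // -[|k] kp //.
    by have [] := np k kp.
  by case.
elim: k => [|k IH] // kp; have [pk pk1] := IH (ltnW kp).
split=> //; have kp' : k.+2 < size p' by rewrite -szp.
have : [set nth x p k.+1; nth x p k.+2] \in cycle_edges p'.
  rewrite -pp'; apply/imsetP; exists (nth x p k.+1); first by rewrite mem_nth // ltnW.
  by rewrite next_nth_succ.
case/mem_cycle_edges => -[_]; first by rewrite pk1 next_nth_succ.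
rewrite pk1 -(next_nth_succ _ up' (ltnW kp')) => /(can_inj (prev_next up')).
rewrite -pk => /eqP; rewrite nth_uniq ?(ltnW (ltnW kp)) //.
by rewrite gtn_eqF.
Qed.

Lemma cycle_edges_rot i c : uniq c -> cycle_edges (rot i c) = cycle_edges c.
Proof.
move=> uc; rewrite /cycle_edges; apply/setP => E.
apply/imsetP/imsetP => -[u]; rewrite ?mem_rot => uin ->; exists u;
  by rewrite ?mem_rot // next_rot.
Qed.

Lemma cycle_edges_rev c : uniq c -> cycle_edges (rev c) = cycle_edges c.
Proof.
move=> uc; rewrite /cycle_edges; apply/setP => E.
apply/imsetP/imsetP => -[u]; rewrite ?mem_rev => uin ->.
  exists (prev c u); first by rewrite mem_prev.
  by rewrite next_rev // next_prev // setUC.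
exists (next c u); first by rewrite mem_rev mem_next.
by rewrite next_rev // prev_next // setUC.
Qed.

(** Rotate the cycle, after reversing it if it runs through the edge from y to
x. *)
Lemma cycle_rooted (e : rel T) c x y : symmetric e -> x != y ->
  uniq c -> cycle e c -> [set x; y] \in cycle_edges c ->
  exists s, [/\ size (x :: y :: s) = size c, uniq (x :: y :: s),
    cycle e (x :: y :: s) & cycle_edges (x :: y :: s) = cycle_edges c].
Proof.
move=> eC nxy.
have fwd d : uniq d -> cycle e d -> x \in d -> next d x = y ->
  exists s, [/\ size (x :: y :: s) = size d, uniq (x :: y :: s),
    cycle e (x :: y :: s) & cycle_edges (x :: y :: s) = cycle_edges d].
  move=> ud cd xd nx; have [i s ds] := rot_to xd.
  have nx' : next (rot i d) x = y by rewrite next_rot.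
  case: s ds => [|y1 s] ds.
    by move: nx'; rewrite ds /= eqxx => yE; rewrite yE eqxx in nxy.
  have yE : y1 = y by move: nx'; rewrite ds /= eqxx.
  exists s; rewrite -yE -ds.
  by rewrite size_rot rot_uniq rot_cycle cycle_edges_rot.
move=> uc cc /mem_cycle_edges[[xc nx]|[yc ny]]; first exact: fwd.
have := fwd (rev c); rewrite rev_uniq rev_cycle size_rev cycle_edges_rev //.
apply=> //; first by rewrite (eq_cycle (e' := e)).
  by rewrite mem_rev -ny mem_next.
by rewrite next_rev // -ny prev_next.
Qed.

End CycleEdges.

Section Girth.

Variables (T : finType) (e : rel T).
Hypotheses (eC : symmetric e) (eI : irreflexive e).

Lemma cycles_of_lengthP g C :
  reflect (exists c, [/\ size c = g, 2 < g, cycle e c, uniq c & C = cycle_edges c])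
          (C \in cycles_of_length e g).
Proof.
rewrite inE; apply: (iffP andP) => [[g2 /existsP[c /and3P[cc uc /eqP->]]]|].
  by exists c; rewrite size_tuple.
case=> c [szc g2 cc uc ->]; split=> //; apply/existsP.
have szc' : size c == g by apply/eqP.
by exists (Tuple szc'); rewrite cc uc eqxx.
Qed.

Lemma edge_neq a b : e a b -> a != b.
Proof. by apply: contraTneq => ->; rewrite eI. Qed.

(** In a graph without triangles, a closed walk of length 5 cannot repeat a
vertex. *)
Lemma girth_ge6P :
  girth_ge6 e <-> forall h, h < 6 -> cycles_of_length e h = set0.
Proof.
split=> [[no3 no4 no5] h h6 | no].
  apply/setP => C; rewrite in_set0; apply/negP => /cycles_of_lengthP[c [szc sz2 cc uc _]].
  rewrite -{}szc in sz2 h6.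
  case: c sz2 h6 cc uc => [|a [|b [|c s]]] // _.
  case: s => [|d [|f [|? ?]]] //= _.
  - by rewrite !andbT => /and3P[ab bc ca] _; apply: (no3 _ _ _ ab bc ca).
  - rewrite !andbT => /and4P[ab bc cd da].
    by case: (no4 _ _ _ _ ab bc cd da) => ->; rewrite !inE eqxx ?orbT ?andbF.
  - by rewrite !andbT => /and5P[ab bc cd df fa] _; apply: (no5 _ _ _ _ _ ab bc cd df fa).
have nocyc s : 2 < size s -> size s < 6 -> cycle e s -> uniq s -> False.
  move=> s2 s6 cs us; have := no _ s6; move/setP/(_ (cycle_edges s)).
  by rewrite in_set0 => /negP; apply; apply/cycles_of_lengthP; exists s.
have no3 a b c : e a b -> e b c -> e c a -> False.
  move=> ab bc ca; apply: (nocyc [:: a; b; c]) => //=; first by rewrite ab bc ca.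
  by rewrite !inE negb_or !edge_neq // eC.
split=> //.
  move=> a b c d ab bc cd da.
  have [ac|ac] := eqVneq a c; first by left.
  have [bd|bd] := eqVneq b d; first by right.
  case: (nocyc [:: a; b; c; d]) => //=; first by rewrite ab bc cd da.
  by rewrite !inE !negb_or ac bd !edge_neq // eC.
move=> a b c d f ab bc cd df fa.
have ac : a != c by apply/eqP => ac; subst c; apply: (no3 a d f).
have ad : a != d by apply/eqP => ad; subst d; apply: (no3 a b c).
have bd : b != d by apply/eqP => bd; subst d; apply: (no3 b f a).
have bf : b != f by apply/eqP => bf; subst f; apply: (no3 b c d).
have cf : c != f by apply/eqP => cf; subst f; apply: (no3 a b c).
apply: (nocyc [:: a; b; c; d; f]) => //=; first by rewrite ab bc cd df fa.
by rewrite !inE !negb_or ac ad bd bf cf !edge_neq // eC.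
Qed.

Hypothesis g6 : girth_ge6 e.

Let no3 := let: And3 h _ _ := g6 in h.
Let no4 := let: And3 _ h _ := g6 in h.

Lemma sum_deg_in_pairs (A B : {set T}) :
  \sum_(a in A) deg_in e B a = #|[set p in setX A B | e p.1 p.2]|.
Proof.
rewrite (eq_bigr _ (fun a _ => deg_inE e B a)) pair_big_dep /= -sum1_card.
rewrite big_mkcond [RHS]big_mkcond /=; apply: eq_bigr => -[a b] _.
by rewrite !inE /=; case: (a \in A); case: (b \in B); case: (e a b).
Qed.

(** A 6-cycle x, y, a, b, c, d is determined by c and b, because a is the only
common neighbour of y and b, and d the only one of c and x. Conversely, an edge
between the two branches can always be completed. *)
Lemma card_edge_cycles x y : e x y ->
  #|[set C in cycles_of_length e 6 | [set x; y] \in C]| =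
  \sum_(c in branch e x y) deg_in e (branch e y x) c.
Proof.
move=> xy.
pose hex (p : T * T * T * T) := [:: p.1.1.1; p.1.1.2; p.1.2; p.2].
(* All ways to continue x, y to a rooted and oriented 6-cycle. *)
pose H := [set p | cycle e [:: x, y & hex p] && uniq [:: x, y & hex p]].
have cardC : #|[set C in cycles_of_length e 6 | [set x; y] \in C]| = #|H|.
  rewrite -(@card_in_imset _ _ (fun p => cycle_edges [:: x, y & hex p])); last first.
    move=> [[[a b] c] d] [[[a' b'] c'] d']; rewrite !inE => /andP[_ u] /andP[_ u'].
    by move/(cycle_edges_inj u u' erefl) => [-> -> -> ->].
  apply: eq_card => C; rewrite inE; apply/andP/imsetP => [[]|].
    case/cycles_of_lengthP => c [szc _ cc uc -> xyc].
    have [s []] := cycle_rooted eC (edge_neq xy) uc cc xyc.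
    rewrite szc; case: s => [|a [|b [|d [|f []]]]] //= _ us cs <-.
    by exists (a, b, d, f); rewrite // inE; apply/andP.
  move=> [p]; rewrite inE => /andP[cp up] ->; split.
    by apply/cycles_of_lengthP; exists [:: x, y & hex p].
  apply/imsetP; exists x; first by rewrite inE eqxx.
  by rewrite /= eqxx.
rewrite sum_deg_in_pairs.
rewrite {}cardC -(@card_in_imset _ _ (fun p : T * T * T * T => (p.1.2, p.1.1.2))).
  apply: eq_card => -[c b]; apply/imsetP/setIdP => [[[[[a b'] c'] d] pH [-> ->]]|[]].
    rewrite inE /= in pH; case/andP: pH => /and5P[_ ya ab bc /and3P[cd dx _]] up.
    rewrite !inE !negb_or -!andbA in up.
    case/and5P: up => _ xa _ xc /and5P[_ ya' yb yc /and5P[yd _ _ _ _]].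
    split; last by rewrite eC.
    apply/setXP; split; apply/branchP.
      by exists d; split; rewrite // 1?eC // eq_sym.
    by exists a; split; rewrite // eq_sym.
  case/setXP => /branchP[d [xd dy dc cx]] /branchP[a [ya ax ab yb]] cb.
  exists (a, b, c, d) => //; rewrite inE /=; apply/andP; split.
    by rewrite xy ya ab eC cb /= eC dc eC xd.
  have xb : x != b by apply/eqP => xb; subst b; apply: (no3 ya ab).
  have yc : y != c by apply/eqP => yc; subst c; apply: (no3 xy _ (_ : e d x)); rewrite eC.
  have ac : a != c.
    apply/eqP => ac; subst c; have [] := @no4 x y a d xy ya; rewrite 1?eC //.
      by move/esym/eqP; apply/negP.
    by move/esym/eqP; apply/negP.
  have ad : a != d by apply/eqP => ad; subst d; apply: (no3 xd _ (_ : e y x)); rewrite eC.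
  have bd : b != d.
    apply/eqP => bd; subst d; have [] := @no4 x y a b xy ya ab; rewrite 1?eC //.
      by move/esym/eqP; apply/negP.
    by move/esym/eqP; apply/negP.
  rewrite !inE !negb_or xb yc ac ad bd (eq_sym x a) ax (eq_sym x c) cx.
  rewrite (eq_sym y b) yb (eq_sym y d) dy (edge_neq xy) (edge_neq xd) (edge_neq ya).
  by rewrite (edge_neq ab) (eq_sym b c) (edge_neq cb) (eq_sym c d) (edge_neq dc).
move=> [[[a b] c] d] [[[a' b'] c'] d'].
rewrite !inE /= => /andP[cp up] /andP[cp' up'] [cc bb].
subst c' b'.
move: cp cp'; rewrite !andbT => /and5P[_ ya ab bc /andP[cd dx]].
move=> /and5P[_ ya' a'b _ /andP[cd' d'x]].
rewrite !inE !negb_or -!andbA in up.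
case/and5P: up => _ _ _ xc /and4P[_ _ yb _].
congr (_, _, _, _).
  by apply: (common_nbr_eq eC g6 yb); rewrite // eC.
by apply: (common_nbr_eq eC g6 xc); rewrite // eC.
Qed.

End Girth.

(** * The biaffine plane *)

Section Biaffine.

Variable F : finFieldType.
Local Notation e := (@biaffine_graph F).
Local Open Scope ring_scope.

Lemma biaffine_sym : symmetric e.
Proof. by case=> [P|L] [P'|L']. Qed.

Lemma biaffine_irr : irreflexive e.
Proof. by case. Qed.

Lemma incident_slope (x y m : F) :
  biaffine_incident ((x, y) : biaffine_point F) (m, y - m * x).
Proof. by rewrite /biaffine_incident /= addrCA subrr addr0. Qed.

Lemma incident_uniq (P P' : biaffine_point F) (L L' : biaffine_line F) :
  biaffine_incident P L -> biaffine_incident P' L ->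
  biaffine_incident P L' -> biaffine_incident P' L' -> P = P' \/ L = L'.
Proof.
case: P P' L L' => [x y] [x' y'] [m b] [m' b']; rewrite /biaffine_incident /=.
move=> /eqP-> /eqP-> /eqP E1 /eqP E2.
have : (m - m') * (x - x') = 0.
  have -> : (m - m') * (x - x') =
     (m * x + b) - (m' * x + b') - ((m * x' + b) - (m' * x' + b')) by ring.
  by rewrite E1 E2 !subrr.
move/eqP; rewrite mulf_eq0 !subr_eq0 => /orP[] /eqP E; [right|left]; subst=> //.
by move/addrI: E1 => ->.
Qed.

Lemma biaffine_girth : girth_ge6 e.
Proof.
split.
- by case=> [?|?] [?|?] [?|?].
- case=> [P|L] [P'|L'] [P''|L''] [P3|L3] //= h1 h2 h3 h4.
    by have [->|->] := incident_uniq h1 h2 h4 h3; [left|right].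
  by have [->|->] := incident_uniq h1 h4 h2 h3; [right|left].
- by case=> [?|?] [?|?] [?|?] [?|?] [?|?].
Qed.

Lemma biaffine_regular : regular_graph e #|F|.
Proof.
case=> [[x y]|[m b]].
  pose f m : biaffine_point F + biaffine_line F := inr (m, y - m * x).
  rewrite -(card_imset _ (_ : injective f)).
    apply: eq_card => -[P|[m b]]; rewrite inE /=.
      by apply/esym/imsetP => -[].
    apply/eqP/imsetP => /= [yE|[m' _ [-> ->]]]; last by rewrite addrC subrK.
    by exists m => //; rewrite /f yE addrC addKr.
  by move=> m m' [].
pose f x : biaffine_point F + biaffine_line F := inl (x, m * x + b).
rewrite -(card_imset _ (_ : injective f)).
  apply: eq_card => -[[x y]|L]; rewrite inE /=; last by apply/esym/imsetP => -[].
  by apply/eqP/imsetP => /= [->|[x' _ [-> ->]]] //; exists x.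
by move=> x x' [].
Qed.

Variables (P : biaffine_point F) (L : biaffine_line F).
Hypothesis PL : biaffine_incident P L.

(** A line joins a point to P unless both lie on the same vertical. *)
Lemma point_branch c : (inl c \in branch e (inl P) (inr L)) =
  (c.1 != P.1) && ~~ biaffine_incident c L.
Proof.
apply/branchP/andP => [[[?|l] [Pl lL cl cP]]|[cP cL]]; first by [].
  split; last first.
    by apply/negP => cL; case: (incident_uniq Pl cl PL cL) => E; rewrite E eqxx in lL cP.
  apply: contraNneq cP => c1; apply/eqP; congr inl.
  move: Pl cl; rewrite /= /biaffine_incident => /eqP P2 /eqP c2.
  by rewrite [c]surjective_pairing [P]surjective_pairing c2 P2 c1.
pose m := (c.2 - P.2) / (c.1 - P.1).
have cP0 : c.1 - P.1 != 0 by rewrite subr_eq0.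
have cl : biaffine_incident c (m, P.2 - m * P.1).
  rewrite /biaffine_incident /= addrCA -mulrBr mulfVK //.
  by rewrite addrC subrK.
exists (inr (m, P.2 - m * P.1)); split=> //.
- by rewrite /= /biaffine_incident /= addrC subrK.
- by apply: contraNneq cL => -[<-].
- by apply: contraNneq cP => -[->].
Qed.

(** A line meets L unless it is parallel to L. *)
Lemma line_branch l : (inr l \in branch e (inr L) (inl P)) =
  (l.1 != L.1) && ~~ biaffine_incident P l.
Proof.
apply/branchP/andP => [[[A|?] [AL AP Al lL]]|[lL Pl]]; last 1 first.
- pose x := (l.2 - L.2) / (L.1 - l.1).
  have lL0 : L.1 - l.1 != 0 by rewrite subr_eq0 eq_sym.
  have Al : biaffine_incident (x, L.1 * x + L.2) l.
    rewrite /biaffine_incident /= -subr_eq0.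
    have -> : L.1 * x + L.2 - (l.1 * x + l.2) = x * (L.1 - l.1) - (l.2 - L.2) by ring.
    by rewrite mulfVK // subrr.
  exists (inl (x, L.1 * x + L.2)); split=> //.
  - by rewrite /= /biaffine_incident.
  - by apply: contraNneq Pl => -[<-].
  - by apply: contraNneq lL => -[->].
- split; last first.
    by apply/negP => Pl; case: (incident_uniq PL AL Pl Al) => E; rewrite E eqxx in lL AP.
  apply: contraNneq lL => l1; apply/eqP; congr inr.
  move: AL Al; rewrite /= /biaffine_incident l1 => /eqP -> /eqP/addrI E.
  by rewrite [l]surjective_pairing [L]surjective_pairing l1 E.
- by [].
Qed.

(** The point and the line opposite to P and L in a hexagon. With r and k the
differences of abscissas and of slopes, the point lies r*k*j above L: it is on
L for j = 0, and the line passes through P for j = 1. *)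
Definition hexagon_pair (p : F * F * F) :
    (biaffine_point F + biaffine_line F) * (biaffine_point F + biaffine_line F) :=
  let x := P.1 + p.1.1 in let m := L.1 + p.1.2 in
  let y := L.1 * x + L.2 + p.1.1 * p.1.2 * p.2 in
  (inl (x, y), inr (m, y - m * x)).

Lemma card_hexagon_pairs :
  (\sum_(c in branch e (inl P) (inr L)) deg_in e (branch e (inr L) (inl P)) c =
  (#|F| - 1) ^ 2 * (#|F| - 2))%N.
Proof.
pose D := setX (setX [set~ (0 : F)] [set~ (0 : F)]) (~: [set (0 : F); 1]).
have <- : #|D| = ((#|F| - 1) ^ 2 * (#|F| - 2))%N.
  have c01 : #|~: [set (0 : F); 1]| = (#|F| - 2)%N.
    by rewrite cardsCs setCK cards2 eq_sym oner_eq0.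
  by rewrite !cardsX !cardsC1 c01 subn1 mulnn.
rewrite sum_deg_in_pairs -(@card_in_imset _ _ hexagon_pair).
  apply: eq_card => -[c l]; apply/setIdP/imsetP.
    case=> /setXP[]; case: c => [c|c]; last first.
      by move=> /branchP[[?|?]] [].
    case: l => [l|l]; first by move=> _ /branchP[[?|?]] [].
    rewrite point_branch line_branch /= => /andP[cP cL] /andP[lL Pl] cl.
    have cP0 : c.1 - P.1 != 0 by rewrite subr_eq0.
    have lL0 : l.1 - L.1 != 0 by rewrite subr_eq0.
    have rk0 : (c.1 - P.1) * (l.1 - L.1) != 0 by rewrite mulf_neq0.
    move: (PL) cl cL Pl; rewrite /biaffine_incident => /eqP P2 /eqP c2 cL Pl.
    exists (c.1 - P.1, l.1 - L.1,
            (c.2 - (L.1 * c.1 + L.2)) / ((c.1 - P.1) * (l.1 - L.1))).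
      rewrite !inE cP0 lL0 /= negb_or mulf_eq0 invr_eq0 (negPf rk0) orbF.
      rewrite subr_eq0 cL /=; apply: contraNneq Pl.
      move=> /(congr1 (fun z => z * ((c.1 - P.1) * (l.1 - L.1)))).
      rewrite mulfVK // mul1r c2 => E; rewrite P2 -subr_eq0; apply/eqP.
      have -> : L.1 * P.1 + L.2 - (l.1 * P.1 + l.2) =
         (c.1 - P.1) * (l.1 - L.1) - (l.1 * c.1 + l.2 - (L.1 * c.1 + L.2)) by ring.
      by rewrite E subrr.
    have xE : P.1 + (c.1 - P.1) = c.1 by rewrite addrC subrK.
    have mE : L.1 + (l.1 - L.1) = l.1 by rewrite addrC subrK.
    have bE : c.2 - l.1 * c.1 = l.2 by rewrite c2 addrC addKr.
    rewrite /hexagon_pair /= xE mE [_ * _ * (_ / _)]mulrC mulfVK //.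
    by rewrite [_ + (c.2 - _)]addrC subrK bE -!surjective_pairing.
  case=> -[[r k] j] pD [-> ->]; rewrite !inE negb_or /= in pD.
  case/andP: pD => /andP[r0 k0] /andP[j0 j1].
  split; last exact: incident_slope.
  apply/setXP; rewrite point_branch line_branch /biaffine_incident /=; split.
    rewrite -subr_eq0 addrC addKr r0 /= -subr_eq0.
    by rewrite [_ + _ * j]addrC addrK !mulf_neq0.
  rewrite -subr_eq0 addrC addKr k0 /=; move: PL; rewrite /biaffine_incident => /eqP ->.
  rewrite -subr_eq0.
  set E := (X in X != 0); have -> : E = r * k * (1 - j) by rewrite /E; ring.
  by rewrite !mulf_neq0 // subr_eq0 eq_sym.
move=> [[r k] j] [[r' k'] j']; rewrite !inE negb_or /= => /andP[/andP[r0 k0] _] _.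
case=> /addrI rr + /addrI kk; rewrite -rr -kk => /addrI/mulfI ->; first by [].
by rewrite mulf_neq0.
Qed.

End Biaffine.

Lemma biaffine_egr (F : finFieldType) : 3 <= #|F| ->
  is_egr (@biaffine_graph F) (2 * #|F| ^ 2) #|F| 6 ((#|F| - 1) ^ 2 * (#|F| - 2)).
Proof.
move=> q3; set e := @biaffine_graph F.
have eC : symmetric e := @biaffine_sym F; have eI : irreflexive e := @biaffine_irr F.
have g6 : girth_ge6 e := biaffine_girth F.
have lam x y : e x y ->
  #|[set C in cycles_of_length e 6 | [set x; y] \in C]| = (#|F| - 1) ^ 2 * (#|F| - 2).
  wlog [P xP] : x y / exists P, x = inl P => [W|].
    case: x y => [P|L] [P'|L'] // xy; first by apply: W => //; exists P.
    by rewrite setUC; apply: W; [exists P' | rewrite eC].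
  subst x; case: y => [//|L] PL.
  by rewrite (card_edge_cycles eC eI g6 PL) card_hexagon_pairs.
split=> //.
- by rewrite card_sum card_prod mulnn addnn mul2n.
- exact: biaffine_regular.
- split; last by move=> h; move: h; apply/(girth_ge6P eC eI).
  have PL : e (inl (0, 0)%R) (inr (0, 0)%R).
    by rewrite /= /biaffine_incident /= mul0r addr0.
  have /card_gt0P[C] : 0 < #|[set C in cycles_of_length e 6 |
      [set inl (0, 0)%R; inr (0, 0)%R] \in C]|.
    by rewrite lam // muln_gt0 expn_gt0 !subn_gt0 (ltnW q3) q3.
  by rewrite inE => /andP[Cin _]; apply/set0Pn; exists C.
Qed.

Lemma egr_order_lower_bound q w : prime_power q -> 3 <= q ->
  egr_exists w q 6 ((q - 1) ^ 2 * (q - 2)) -> 2 * q ^ 2 <= w.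
Proof.
move=> pq q3 [T [e [[eC eI] <- reg [/set0Pn[C C6] small] lam]]].
have g6 : girth_ge6 e by apply/(girth_ge6P eC eI).
have [c [szc _ cc _ _]] := cycles_of_lengthP _ _ _ C6.
case: c szc cc => [|x [|y s]] //= _ /andP[xy _].
apply: (order_lower_bound eC eI g6 reg pq q3 xy).
by rewrite -(card_edge_cycles eC eI g6 xy) lam.
Qed.

Theorem theorem4p3 (q : nat) (hq : prime_power q) (hq3 : 3 <= q)
    (F : finFieldType) (hF : #|F| = q) :
  extremal_egr (@biaffine_graph F) (2 * q ^ 2) q 6 ((q - 1) ^ 2 * (q - 2)).
Proof.
have egr : is_egr (@biaffine_graph F) (2 * q ^ 2) q 6 ((q - 1) ^ 2 * (q - 2)).
  by rewrite -hF; apply: biaffine_egr; rewrite hF.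
split=> //; split.
  by exists (biaffine_point F + biaffine_line F)%type, (@biaffine_graph F).
by move=> w; apply: egr_order_lower_bound.
Qed.
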